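(* Let $t$ be any finite rooted planar tree with at least one edge, let $q\ge1$ be an integer, and let $a$ be an integer coprime to $q$. Then there are infinitely many positive integers $n$ with $n\equiv a\pmod q$ and $t(n)=t$.
   Context: Every integer $n\ge 1$ is assigned a finite rooted planar tree $t(n)$: $t(1)$ is the single-vertex tree; if $n=p_1^{a_1}\cdots p_s^{a_s}$ with primes $p_1<\dots<p_s$ and $a_i\ge1$, then $t(n)$ consists of a root with $s$ edges to children, ordered left to right, the $i$-th edge leading to a copy of $t(a_i)$ rooted at that child. Every finite rooted planar tree arises as $t(n)$ for some $n$. *)

(* Defs.v *)
From mathcomp Require Import all_boot all_order all_algebra.
From mathcomp Require Import classical_sets cardinality.

Set Implicit Arguments.
Unset Strict Implicit.
Unset Printing Implicit Defensive.

(* The list gives the subtrees at the children of the root, left to right. *)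
Inductive planar_tree : Type := Node of seq planar_tree.

Fixpoint num_edges (t : planar_tree) : nat :=
  let: Node ts := t in sumn [seq (num_edges u).+1 | u <- ts].

(* The first argument is fuel: since logn p n < n for p in primes n, fuel n
   suffices, as tree_ofE below shows. *)
Fixpoint tree_of_rec (k n : nat) : planar_tree :=
  if k is k'.+1
  then Node [seq tree_of_rec k' (logn p n) | p <- primes n]
  else Node [::].

(* t(n); primes n is in increasing order. The value at 0 is a junk value. *)
Definition tree_of (n : nat) : planar_tree := tree_of_rec n n.

Lemma tree_of_rec_fuel (k n : nat) : n <= k -> tree_of_rec k n = tree_of n.
Proof.
suff fuel k1 k2 m : m <= k1 -> m <= k2 -> tree_of_rec k1 m = tree_of_rec k2 m.
  by move=> le_nk; apply: fuel.
elim: k1 k2 m => [|k1 IH] [|k2] m //=.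
- by rewrite leqn0 => /eqP ->.
- by move=> _; rewrite leqn0 => /eqP ->.
move=> le1 le2; congr Node; apply/eq_in_map => p.
rewrite mem_primes => /and3P[_ m_gt0 _].
have lt_log := ltn_logl p m_gt0.
by apply: IH; rewrite -ltnS; apply: leq_trans lt_log _.
Qed.

Lemma tree_of1 : tree_of 1 = Node [::].
Proof. by []. Qed.

Lemma tree_ofE (n : nat) :
  tree_of n = Node [seq tree_of (logn p n) | p <- primes n].
Proof.
case: n => [|n] //; rewrite {1}/tree_of.
rewrite [tree_of_rec _ _]/=; congr Node; apply/eq_in_map => p _.
by apply: tree_of_rec_fuel; rewrite -ltnS ltn_logl.
Qed.

(* Main.v *)
Require Import Defs.
From mathcomp Require Import all_boot all_order all_algebra.
From mathcomp Require Import fingroup cyclic separable cyclotomic algC classfun character.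
From mathcomp Require Import boolp classical_sets cardinality.
From mathcomp Require Import reals sequences exp complex Rstruct.
From mathcomp Require Import ring lra zify.

(** The tree with one edge is t(p) for p prime, so the statement contains
    Dirichlet's theorem on primes in arithmetic progressions; conversely
    Dirichlet's theorem suffices. By induction on the tree, each subtree at a
    child of the root is t(e) for some e = 1 modulo totient q; taking increasing
    primes p_1 = a and p_2, ..., p_s = 1 modulo q with these exponents gives
    p_1^e_1 ... p_s^e_s = a modulo q.

    Dirichlet's theorem is proved by finite sums only, following Mertens,
    Shapiro and Monsky. For a nonprincipal character chi, let T(N) be the sum of
    chi(n) Lambda(n) / n over n <= N, and L the sum of the series chi(n) / n.
    Möbius inversion gives T(N) = O(1) if L <> 0 and T(N) = - ln N + O(1) if
    L = 0. Summing over all characters, T(N) is unbounded for at most one of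
    them, hence not for a non-real one and its conjugate; a real character with
    L = 0 would make the Lambert series of chi bounded near 1, although its
    coefficients \sum_(d | n) chi(d) are nonnegative and at least 1 at squares.
    Hence all T(N) are bounded, and since the principal character contributes
    at least ln N + O(1), orthogonality yields infinitely many primes in each
    class. *)

Set Implicit Arguments.
Unset Strict Implicit.
Unset Printing Implicit Defensive.

Import Order.TTheory GRing.Theory Num.Theory.

Local Open Scope ring_scope.

(** * Sums over divisors *)

Lemma dvdn_div_gt0 d n : (0 < n)%N -> (d %| n)%N -> (0 < n %/ d)%N.
Proof. by move=> n_gt0 dn; rewrite divn_gt0 ?(dvdn_gt0 n_gt0 dn) //; apply: dvdn_leq. Qed.

Lemma prime_mul_ind (P : nat -> Prop) : P 1%N ->
  (forall p n, prime p -> (0 < n)%N -> P n -> P (p * n)%N) ->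
  forall n, (0 < n)%N -> P n.
Proof.
move=> P1 PM; elim/ltn_ind=> n IHn n_gt0; have [n_le1|n_gt1] := leqP n 1.
  by have -> : n = 1%N by apply/anti_leq; rewrite n_le1.
have [p p_pr pn] := pdivP n_gt1.
have quo_gt0 := dvdn_div_gt0 n_gt0 pn.
rewrite -(divnK pn) mulnC; apply: PM => //; apply: IHn => //.
by rewrite ltn_Pdiv ?prime_gt1.
Qed.

Lemma pfactor_ind (P : nat -> Prop) : P 1%N ->
  (forall p k n, prime p -> ~~ (p %| n)%N -> (0 < n)%N -> P n -> P (p ^ k * n)%N) ->
  forall n, (0 < n)%N -> P n.
Proof.
move=> P1 PM; elim/ltn_ind=> n IHn n_gt0; have [n_le1|n_gt1] := leqP n 1.
  by have -> : n = 1%N by apply/anti_leq; rewrite n_le1.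
have [p p_pr pn] := pdivP n_gt1.
have [m co_pm nE] := pfactor_coprime p_pr n_gt0.
have m_gt0 : (0 < m)%N by move: n_gt0; rewrite nE muln_gt0 => /andP[].
rewrite nE mulnC; apply: PM => //; first by rewrite -prime_coprime.
apply: IHn => //; rewrite [ltnRHS]nE -{1}(muln1 m) ltn_pmul2l //.
by rewrite -(expn0 p) ltn_exp2l ?prime_gt1 // logn_gt0 mem_primes p_pr n_gt0 pn.
Qed.

Section DivisorSums.
Variable V : nmodType.
Implicit Types (F : nat -> V) (g : nat -> nat -> V).

Lemma sum_divisors n N F : (0 < n <= N)%N ->
  \sum_(d <- divisors n) F d = \sum_(1 <= d < N.+1 | (d %| n)%N) F d.
Proof.
case/andP=> n_gt0 le_nN; rewrite -[RHS]big_filter; apply: perm_big.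
apply: uniq_perm; rewrite ?divisors_uniq ?filter_uniq ?iota_uniq // => d.
rewrite -dvdn_divisors // mem_filter mem_index_iota ltnS.
case: (boolP (d %| n)%N) => //= dn.
by rewrite (dvdn_gt0 n_gt0 dn) (leq_trans (dvdn_leq n_gt0 dn)).
Qed.

Lemma sum_divisors_exchange g N :
  \sum_(1 <= d < N.+1) \sum_(1 <= m < (N %/ d).+1) g d m =
  \sum_(1 <= n < N.+1) \sum_(d <- divisors n) g d (n %/ d)%N.
Proof.
elim: N => [|N IHN]; first by rewrite !big_geq.
rewrite [RHS]big_nat_recr //= -IHN (@sum_divisors _ N.+1) ?leqnn //.
rewrite [in RHS](big_mkcond (dvdn^~ _)) /=.
have -> : \sum_(1 <= d < N.+1) \sum_(1 <= m < (N %/ d).+1) g d m =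
          \sum_(1 <= d < N.+2) \sum_(1 <= m < (N %/ d).+1) g d m.
  by rewrite [RHS]big_nat_recr //= divn_small // [X in _ + X]big_geq // addr0.
rewrite -big_split /=; apply: eq_big_nat => d /andP[d_gt0 _].
rewrite divnS //; case: (d %| N.+1)%N => /=; last by rewrite addr0.
by rewrite add1n big_nat_recr.
Qed.

Lemma sum_divisors_quotient n g : (0 < n)%N ->
  \sum_(d <- divisors n) \sum_(e <- divisors (n %/ d)) g d e =
  \sum_(1 <= d < n.+1) \sum_(1 <= e < n.+1 | (d * e %| n)%N) g d e.
Proof.
move=> n_gt0; rewrite (@sum_divisors n n) ?n_gt0 ?leqnn // big_mkcond /=.
apply: eq_big_nat => d /andP[d_gt0 le_dn]; case: ifP => [dn|/negbT dNn].
  rewrite (@sum_divisors _ n) ?leq_div ?dvdn_div_gt0 //.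
  by apply: eq_bigl => e; rewrite dvdn_divRL // mulnC.
by rewrite big_pred0 // => e; apply: contraNF dNn; apply: dvdn_trans (dvdn_mulr _ _).
Qed.

Lemma sum_divisors_swap n g : (0 < n)%N ->
  \sum_(d <- divisors n) \sum_(e <- divisors (n %/ d)) g d e =
  \sum_(e <- divisors n) \sum_(d <- divisors (n %/ e)) g d e.
Proof.
move=> n_gt0; rewrite !sum_divisors_quotient // (exchange_big_dep_nat xpredT) //=.
by apply: eq_big_nat => e _; apply: eq_bigl => d; rewrite mulnC.
Qed.

Lemma sum_divisors_prime_mul p n F : prime p -> (0 < n)%N ->
  \sum_(d <- divisors (p * n)) F d =
  \sum_(d <- divisors n | ~~ (p %| d)%N) F d + \sum_(d <- divisors n) F (p * d)%N.
Proof.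
move=> p_pr n_gt0; have p_gt0 := prime_gt0 p_pr.
rewrite (perm_big ([seq d <- divisors n | ~~ (p %| d)%N] ++ map (muln p) (divisors n))).
  by rewrite big_cat big_filter big_map.
have mul_inj : injective (muln p) by move=> d e /eqP; rewrite eqn_pmul2l // => /eqP.
apply: uniq_perm; first exact: divisors_uniq.
  rewrite cat_uniq filter_uniq ?divisors_uniq // map_inj_uniq ?divisors_uniq // andbT.
  by apply/hasPn => _ /mapP[d _ ->]; rewrite mem_filter dvdn_mulr.
move=> d; rewrite mem_cat mem_filter -!dvdn_divisors ?muln_gt0 ?p_gt0 //.
case: (boolP (p %| d)%N) => [/dvdnP[e ->]|pNd] /=.
  by rewrite mulnC dvdn_pmul2l // mem_map // dvdn_divisors.
rewrite Gauss_dvdr; last by rewrite coprime_sym prime_coprime.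
rewrite orbC; case: mapP => [[e _ dE]|//].
by rewrite dE dvdn_mulr in pNd.
Qed.

Lemma sum_divisors_pfactor p k n F : prime p -> (0 < n)%N -> ~~ (p %| n)%N ->
  \sum_(d <- divisors (p ^ k * n)) F d =
  \sum_(i < k.+1) \sum_(d <- divisors n) F (p ^ i * d)%N.
Proof.
move=> p_pr n_gt0 pNn; have p_gt0 := prime_gt0 p_pr.
elim: k F => [|k IHk] F.
  by rewrite big_ord1 mul1n; apply: eq_bigr => d _; rewrite mul1n.
rewrite expnS -mulnA sum_divisors_prime_mul ?muln_gt0 ?expn_gt0 ?p_gt0 //.
rewrite big_ord_recl IHk; congr (_ + _); last first.
  by apply: eq_bigr => i _; apply: eq_bigr => d _; rewrite mulnA -expnS.
rewrite -big_filter; under [RHS]eq_bigr => d _ do rewrite mul1n.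
apply: perm_big; apply: uniq_perm; rewrite ?filter_uniq ?divisors_uniq // => d.
rewrite mem_filter -!dvdn_divisors ?muln_gt0 ?expn_gt0 ?p_gt0 //.
have [dn|dNn] := boolP (d %| n)%N.
  by rewrite dvdn_mull // andbT; apply: contra pNn => /dvdn_trans->.
apply: contraNF dNn => /andP[pNd].
by rewrite Gauss_dvdr // coprimeXr // coprime_sym prime_coprime.
Qed.

End DivisorSums.

Definition dirichlet_mul (R : pzSemiRingType) (f g : nat -> R) (n : nat) : R :=
  \sum_(d <- divisors n) f d * g (n %/ d)%N.

Lemma dirichlet_mulr1 (R : pzSemiRingType) (f : nat -> R) n :
  dirichlet_mul f (fun=> 1) n = \sum_(d <- divisors n) f d.
Proof. by apply: eq_bigr => d _; rewrite mulr1. Qed.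

Lemma dirichlet_mulCA (R : comPzSemiRingType) (f g h : nat -> R) n : (0 < n)%N ->
  dirichlet_mul f (dirichlet_mul g h) n = dirichlet_mul g (dirichlet_mul f h) n.
Proof.
move=> n_gt0; rewrite /dirichlet_mul.
under eq_bigr => d _ do rewrite mulr_sumr.
rewrite (sum_divisors_swap (fun d e => f d * (g e * h (n %/ d %/ e)%N))) //.
apply: eq_bigr => e _; rewrite mulr_sumr; apply: eq_bigr => d _.
by rewrite mulrCA divnAC.
Qed.

Lemma eq_dirichlet_mulr (R : pzSemiRingType) (f g g' : nat -> R) n : (0 < n)%N ->
  (forall m, (0 < m)%N -> g m = g' m) -> dirichlet_mul f g n = dirichlet_mul f g' n.
Proof.
move=> n_gt0 eq_g; apply: eq_big_seq => d.
by rewrite -dvdn_divisors // => dn; rewrite eq_g // dvdn_div_gt0.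
Qed.

Lemma dirichlet_mulr_delta (R : pzSemiRingType) (f : nat -> R) n : (0 < n)%N ->
  dirichlet_mul f (fun m => (m == 1%N)%:R) n = f n.
Proof.
move=> n_gt0; rewrite /dirichlet_mul (bigD1_seq n) ?divisors_uniq ?divisors_id //=.
rewrite divnn n_gt0 mulr1 big_seq_cond big1 ?addr0 // => d /andP[].
rewrite -dvdn_divisors // => dn /eqP dNn; have [quo1|_] := eqVneq (n %/ d)%N 1%N.
  by case: dNn; rewrite -[RHS](divnK dn) quo1 mul1n.
by rewrite mulr0.
Qed.

(** * Möbius and von Mangoldt functions *)

Definition mobius (R : pzRingType) (n : nat) : R :=
  if all (fun p => logn p n == 1%N) (primes n) then (-1) ^+ size (primes n) else 0.

Section Mobius.
Variable R : pzRingType.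
Local Notation mobius := (mobius R).

Lemma mobius_prime_mul p n : prime p -> (0 < n)%N ->
  mobius (p * n) = if (p %| n)%N then 0 else - mobius n.
Proof.
move=> p_pr n_gt0; have p_gt0 := prime_gt0 p_pr.
case: (boolP (p %| n)%N) => [pn|pNn].
  rewrite /mobius; case: ifP => // /allP/(_ p).
  rewrite mem_primes p_pr muln_gt0 p_gt0 n_gt0 dvdn_mulr // lognM // => /(_ isT).
  by rewrite logn_prime // eqxx add1n eqSS -leqn0 leqNgt -pfactor_dvdn // expn1 pn.
have pNp : p \notin primes n by rewrite mem_primes (negbTE pNn) !andbF.
have primes_pn : perm_eq (primes (p * n)) (p :: primes n).
  apply: uniq_perm; rewrite ?primes_uniq //= ?pNp ?primes_uniq // => r.
  by rewrite primesM // in_cons primes_prime // inE.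
rewrite /mobius (perm_size primes_pn) (perm_all _ primes_pn) /=.
rewrite lognM // logn_prime // eqxx (lognE p n) p_pr n_gt0 (negbTE pNn) /=.
rewrite exprS mulN1r.
rewrite (@eq_in_all _ _ (fun r => logn r n == 1%N)); last first.
  move=> r rn; rewrite lognM // (logn_prime _ p_pr); case: (eqVneq r p) => // re.
  by rewrite re in rn; rewrite rn in pNp.
by case: ifP; rewrite ?oppr0.
Qed.

Lemma sum_mobius n : (0 < n)%N -> \sum_(d <- divisors n) mobius d = (n == 1%N)%:R.
Proof.
move: n; apply: prime_mul_ind => [|p n p_pr n_gt0 _]; first by rewrite big_seq1.
have -> : (p * n == 1)%N = false by rewrite muln_eq1 gtn_eqF // prime_gt1.
rewrite sum_divisors_prime_mul // big_mkcond -big_split /=; apply: big1_seq => d.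
rewrite -dvdn_divisors // => dn; rewrite mobius_prime_mul ?(dvdn_gt0 n_gt0 dn) //.
by case: (p %| d)%N; rewrite /= ?addr0 ?subrr.
Qed.

End Mobius.

Lemma norm_mobius_le1 (R : numDomainType) n : `|mobius R n| <= 1.
Proof. by rewrite /mobius; case: ifP => _; rewrite ?normr0 // normrX normrN1 expr1n. Qed.

Section Mangoldt.
Variable R : realType.
Local Notation mobius := (mobius R).

Definition mangoldt (n : nat) : R := if primes n is [:: p] then ln p%:R else 0.

Lemma ln_nat_ge0 n : 0 <= ln n%:R :> R.
Proof. by case: n => [|n]; [rewrite ln0|rewrite ln_ge0 ?ler1n]. Qed.

Lemma mangoldt_ge0 n : 0 <= mangoldt n.
Proof. by rewrite /mangoldt; case: (primes n) => [|p []] // *; exact: ln_nat_ge0. Qed.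

Lemma mangoldtX n k : (0 < k)%N -> mangoldt (n ^ k) = mangoldt n.
Proof. by move=> k_gt0; rewrite /mangoldt primesX. Qed.

Lemma mangoldt_neq0 n : mangoldt n != 0 ->
  exists p k, [/\ prime p, (0 < k)%N & n = (p ^ k)%N].
Proof.
rewrite /mangoldt; case primes_n: (primes n) => [|p [|//]]; rewrite ?eqxx // => _.
have: p \in primes n by rewrite primes_n inE.
move=> p_n; have := p_n; rewrite mem_primes => /and3P[p_pr n_gt0 _].
exists p, (logn p n); split=> //; first by rewrite logn_gt0.
rewrite -p_part; apply/esym/part_pnat_id/pnatP => // r r_pr rn.
have: r \in primes n by rewrite mem_primes r_pr n_gt0 rn.
by rewrite primes_n inE => /eqP ->; rewrite inE.
Qed.

Lemma mangoldt_prime_mul p n : prime p -> (0 < n)%N ->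
  mangoldt (p * n) =
  if (p %| n)%N then mangoldt n else (n == 1%N)%:R * ln p%:R.
Proof.
move=> p_pr n_gt0; have p_gt0 := prime_gt0 p_pr; rewrite /mangoldt.
have primes_pn r : (r \in primes (p * n)) = (r == p) || (r \in primes n).
  by rewrite primesM // primes_prime // inE.
case: ifP => [pn|pNn].
  rewrite (_ : primes (p * n) = primes n) //.
  apply: (irr_sorted_eq ltn_trans ltnn); rewrite ?sorted_primes // => r.
  by rewrite primes_pn; case: eqP => // ->; rewrite mem_primes p_pr n_gt0 pn.
have [->|n_neq1] := eqVneq n 1%N; first by rewrite muln1 primes_prime // mul1r.
rewrite mul0r; have n_gt1 : (1 < n)%N by rewrite ltn_neqAle eq_sym n_neq1.
have := primes_uniq (p * n); have := primes_pn p; have := primes_pn (pdiv n).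
rewrite eqxx [_ \in primes n]mem_primes pdiv_prime // n_gt0 pdiv_dvd orbT /=.
case: (primes _) => [|r [|//]] //; rewrite !inE => /eqP<- /eqP pE _.
by rewrite pE pdiv_dvd in pNn.
Qed.

Lemma sum_mangoldt n : (0 < n)%N -> \sum_(d <- divisors n) mangoldt d = ln n%:R.
Proof.
move: n; apply: prime_mul_ind => [|p n p_pr n_gt0 IHn]; first by rewrite big_seq1 ln1.
rewrite natrM lnM ?posrE ?ltr0n ?(prime_gt0 p_pr) // -IHn sum_divisors_prime_mul //.
have -> : ln p%:R = \sum_(d <- divisors n) (d == 1%N)%:R * ln p%:R :> R.
  rewrite (bigD1_seq 1%N) ?divisors_uniq ?divisor1 //= mul1r big1 ?addr0 // => d.
  by move=> /negbTE->; rewrite mul0r.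
rewrite big_mkcond -!big_split /=; apply: eq_big_seq => d; rewrite -dvdn_divisors // => dn.
rewrite mangoldt_prime_mul ?(dvdn_gt0 n_gt0 dn) //.
case: (boolP (p %| d)%N) => pd /=; last by rewrite addrC.
case: eqP => [d1|_]; last by rewrite mul0r.
by rewrite d1 dvdn1 gtn_eqF ?prime_gt1 in pd.
Qed.

Lemma mobius_ln n : (0 < n)%N ->
  dirichlet_mul mobius (fun m => ln m%:R) n = mangoldt n.
Proof.
move=> n_gt0; transitivity (dirichlet_mul mobius (dirichlet_mul mangoldt (fun=> 1)) n).
  by apply: eq_dirichlet_mulr => // m m_gt0; rewrite dirichlet_mulr1 sum_mangoldt.
rewrite dirichlet_mulCA // -[RHS]dirichlet_mulr_delta //.
by apply: eq_dirichlet_mulr => // m m_gt0; rewrite dirichlet_mulr1 sum_mobius.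
Qed.

Lemma sum_mobius_ln n : (0 < n)%N ->
  \sum_(d <- divisors n) mobius d * ln d%:R = - mangoldt n.
Proof.
move=> n_gt0; apply/eqP; rewrite -addr_eq0 -mobius_ln // -big_split /=.
rewrite (@eq_big_seq _ _ _ _ _ _ (fun d => mobius d * ln n%:R)) => [|d].
  rewrite -mulr_suml sum_mobius //.
  by case: (n =P 1%N) => [->|_]; rewrite ?ln1 ?mulr0 ?mul0r.
rewrite -dvdn_divisors // => dn /=; have d_gt0 := dvdn_gt0 n_gt0 dn.
rewrite -mulrDr -lnM ?posrE ?ltr0n ?dvdn_div_gt0 //.
by rewrite -natrM mulnC divnK.
Qed.

End Mangoldt.

(** * Abel summation *)

Lemma sum_by_parts (R : comPzRingType) (w r : nat -> R) m n : (m <= n)%N ->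
  \sum_(m <= k < n) w k * r k =
  w n * (\sum_(m <= k < n) r k) +
  \sum_(m <= k < n) (w k - w k.+1) * \sum_(m <= i < k.+1) r i.
Proof.
move=> /subnKC <-; elim: (n - m)%N => [|j IHj].
  by rewrite addn0 !big_geq // mulr0 addr0.
rewrite addnS !big_nat_recr ?leq_addr //= IHj; ring.
Qed.

Lemma abel_bound (R : realDomainType) (w r : nat -> R) (K : R) m n :
  (forall i j, `|\sum_(i <= k < j) r k| <= K) ->
  (forall k, (m <= k)%N -> 0 <= w k) -> (forall k, (m <= k)%N -> w k.+1 <= w k) ->
  `|\sum_(m <= k < n) w k * r k| <= w m * K.
Proof.
move=> sum_r w_ge0 w_anti; have [le_mn|lt_nm] := leqP m n; last first.
  by rewrite big_geq ?normr0 ?mulr_ge0 ?w_ge0 ?(le_trans _ (sum_r 0 0)) // ltnW.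
rewrite sum_by_parts //; apply: le_trans (ler_normD _ _) _.
have -> : w m * K = w n * K + \sum_(m <= k < n) (w k - w k.+1) * K.
  rewrite -mulr_suml -[\sum_(_ <= _ < _) _]opprK -sumrN.
  under eq_bigr => k _ do rewrite opprB.
  by rewrite telescope_sumr // opprB mulrBl addrC subrK.
apply: lerD; first by rewrite normrM ger0_norm ?w_ge0 // ler_wpM2l ?w_ge0.
apply: le_trans (ler_norm_sum _ _ _) _; apply: ler_sum_nat => k /andP[le_mk _].
have dw_ge0 : 0 <= w k - w k.+1 by rewrite subr_ge0 w_anti.
by rewrite normrM ger0_norm // ler_wpM2l.
Qed.

Lemma limit_of_tail_bound (R : realType) (s e : nat -> R) :
  (forall m n, (m <= n)%N -> `|s n - s m| <= e m) ->
  exists L, forall n, `|s n - L| <= e n.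
Proof.
move=> tail; pose E := [set s n - e n | n in [set: nat]]%classic.
have e_ge0 n : 0 <= e n := le_trans (normr_ge0 _) (tail n n (leqnn n)).
have lower_le_upper m n : s m - e m <= s n + e n.
  have [mn|/ltnW nm] := leqP m n; [have := tail _ _ mn|have := tail _ _ nm];
  rewrite ler_norml => /andP[]; have := e_ge0 m; have := e_ge0 n; lra.
have supE : has_sup E.
  split; first by exists (s 0%N - e 0%N), 0%N.
  by exists (s 0%N + e 0%N) => _ [m _ <-].
exists (sup E) => n; rewrite ler_distl; apply/andP; split.
  rewrite lerBlDr; apply: ge_sup; first by case: supE.
  by move=> _ [m _ <-].
by rewrite -lerBlDr; apply: ub_le_sup; [case: supE|exists n].
Qed.

Lemma abel_limit (R : realType) (w r : nat -> R) (K : R) m :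
  (forall i j, `|\sum_(i <= k < j) r k| <= K) ->
  (forall k, (m <= k)%N -> 0 <= w k) -> (forall k, (m <= k)%N -> w k.+1 <= w k) ->
  exists L, forall n, (m <= n)%N -> `|\sum_(m <= k < n) w k * r k - L| <= w n * K.
Proof.
move=> sum_r w_ge0 w_anti.
pose s j := \sum_(m <= k < m + j) w k * r k.
have [|L lim_s] := @limit_of_tail_bound R s (fun j => w (m + j)%N * K).
  move=> i j le_ij; rewrite /s (@big_cat_nat _ _ _ (m + i)) ?leq_addr ?leq_add2l //=.
  rewrite addrAC subrr add0r; have ge_m k : (m + i <= k)%N -> (m <= k)%N.
    exact/leq_trans/leq_addr.
  by apply: abel_bound => // k /ge_m; [exact: w_ge0|exact: w_anti].
by exists L => n /subnKC <-; exact: lim_s.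
Qed.

(** * Complex numbers normed over the reals *)

(* Written [`|x|], the norm of [x : Rcomplex R] would be [R[i]]-valued. *)
Local Notation normC := (@Num.norm _ (Rcomplex _)).

Section RcomplexNorm.
Variable R : rcfType.
Local Notation C := (Rcomplex R).
Local Notation Re := (@complex.Re R).
Local Notation Im := (@complex.Im R).
Implicit Types (x y : C) (a : R).

Lemma Rcomplex_normE x : normC x = Num.sqrt (Re x ^+ 2 + Im x ^+ 2).
Proof. by case: x. Qed.

Lemma Rcomplex_normM x y : normC (x * y) = normC x * normC y.
Proof. exact: ComplexField.Normc.normcM. Qed.

Lemma Rcomplex_norm1 : normC (1 : C) = 1.
Proof. exact: ComplexField.Normc.normc1. Qed.

Lemma Rcomplex_normX x n : normC (x ^+ n) = normC x ^+ n.
Proof.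
elim: n => [|n IHn]; first by rewrite !expr0 Rcomplex_norm1.
by rewrite !exprS Rcomplex_normM IHn.
Qed.

Lemma Re_scale a x : Re (a *: x) = a * Re x.
Proof. by case: x. Qed.

Lemma Im_scale a x : Im (a *: x) = a * Im x.
Proof. by case: x. Qed.

Lemma Rcomplex_normZ a x : normC (a *: x) = `|a| * normC x.
Proof.
rewrite !Rcomplex_normE Re_scale Im_scale !exprMn -mulrDr.
by rewrite sqrtrM ?sqr_ge0 // sqrtr_sqr.
Qed.

Lemma Rcomplex_scalerAr a x y : x * (a *: y) = a *: (x * y).
Proof. by rewrite mulrC -scalerAl mulrC. Qed.

Lemma Rcomplex_norm_conj x : normC (conjc x) = normC x.
Proof. by case: x => b c; rewrite !Rcomplex_normE /= sqrrN. Qed.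

Lemma ReD x y : Re (x + y) = Re x + Re y.
Proof. exact: raddfD. Qed.

Lemma Re_sum (I : Type) (s : seq I) (P : pred I) (F : I -> C) :
  Re (\sum_(i <- s | P i) F i) = \sum_(i <- s | P i) Re (F i).
Proof. exact: raddf_sum. Qed.

Lemma Im_sum (I : Type) (s : seq I) (P : pred I) (F : I -> C) :
  Im (\sum_(i <- s | P i) F i) = \sum_(i <- s | P i) Im (F i).
Proof. exact: raddf_sum. Qed.

Lemma norm_Re_le x : `|Re x| <= normC x.
Proof. by rewrite Rcomplex_normE -sqrtr_sqr ler_wsqrtr // lerDl sqr_ge0. Qed.

Lemma norm_Im_le x : `|Im x| <= normC x.
Proof. by rewrite Rcomplex_normE -sqrtr_sqr ler_wsqrtr // lerDr sqr_ge0. Qed.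

Lemma Re_le_norm x : Re x <= normC x.
Proof. exact: le_trans (ler_norm _) (norm_Re_le x). Qed.

Lemma oppr_norm_le_Re x : - normC x <= Re x.
Proof. by have := norm_Re_le x; rewrite ler_norml => /andP[]. Qed.

Lemma Rcomplex_norm_le x : normC x <= `|Re x| + `|Im x|.
Proof.
rewrite Rcomplex_normE -[leRHS]ger0_norm ?addr_ge0 // -[leRHS]sqrtr_sqr ler_wsqrtr //.
by rewrite sqrrD !real_normK ?num_real // addrAC lerDl mulrn_wge0 // mulr_ge0.
Qed.

End RcomplexNorm.

Lemma Rcomplex_abel_limit (R : realType) (w : nat -> R) (chi : nat -> Rcomplex R)
    (K : R) m :
  (forall i j, normC (\sum_(i <= k < j) chi k) <= K) ->
  (forall k, (m <= k)%N -> 0 <= w k) -> (forall k, (m <= k)%N -> w k.+1 <= w k) ->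
  exists L, forall n, (m <= n)%N ->
    normC (\sum_(m <= k < n) w k *: chi k - L) <= 2 * K * w n.
Proof.
move=> sum_chi w_ge0 w_anti.
have sum_Re i j : `|\sum_(i <= k < j) complex.Re (chi k)| <= K.
  by rewrite -Re_sum; apply: le_trans (norm_Re_le _) (sum_chi i j).
have sum_Im i j : `|\sum_(i <= k < j) complex.Im (chi k)| <= K.
  by rewrite -Im_sum; apply: le_trans (norm_Im_le _) (sum_chi i j).
have [Lr lim_Re] := abel_limit sum_Re w_ge0 w_anti.
have [Li lim_Im] := abel_limit sum_Im w_ge0 w_anti.
exists (Complex Lr Li) => n le_mn; apply: le_trans (Rcomplex_norm_le _) _.
rewrite !raddfB /= Re_sum Im_sum.
under eq_bigr => k _ do rewrite Re_scale.
under [X in _ + `|X - _|]eq_bigr => k _ do rewrite Im_scale.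
by have := lim_Re n le_mn; have := lim_Im n le_mn; lra.
Qed.

(** * Logarithmic sums *)

Lemma ler_sum_subset (R : numDomainType) (I : eqType) (s t : seq I) (F : I -> R) :
  uniq s -> {subset s <= t} -> {in t, forall i, 0 <= F i} ->
  \sum_(i <- s) F i <= \sum_(i <- t) F i.
Proof.
elim: s t => [|x s IHs] t /=.
  by move=> _ _ F_ge0; rewrite big_nil big_seq sumr_ge0.
move=> /andP[xNs uniq_s] sub_t F_ge0.
have xt : x \in t by rewrite sub_t ?mem_head.
rewrite big_cons (big_rem x xt) /= lerD2l; apply: IHs => // [y ys|y].
  by rewrite rem_mem ?sub_t ?inE ?ys ?orbT //; apply: contraNneq xNs => <-.
by move/mem_rem; exact: F_ge0.
Qed.

Lemma sum_exprn_le (R : realFieldType) (x : R) m n : 0 <= x < 1 ->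
  \sum_(m <= k < n) x ^+ k <= x ^+ m / (1 - x).
Proof.
move=> /andP[x_ge0 x_lt1]; have x1_gt0 : 0 < 1 - x by rewrite subr_gt0.
have [le_mn|/ltnW le_nm] := leqP m n; last first.
  by rewrite big_geq // divr_ge0 ?exprn_ge0 // ltW.
rewrite ler_pdivlMr // mulr_suml (telescope_sumr_eq (fun k => - x ^+ k)) // => [|k _].
  by rewrite opprK addrC gerBl exprn_ge0.
by rewrite exprS; ring.
Qed.

Section Logarithm.
Variable R : realType.
Implicit Types x y : R.

Lemma ln_le_subr1 x : 0 < x -> ln x <= x - 1.
Proof.
by move=> x_gt0; have := @le_ln1Dx R (x - 1); rewrite addrCA subrr addr0; apply; lra.
Qed.

Lemma ln_natS_sub_le n : (0 < n)%N -> n%:R * (ln n.+1%:R - ln n%:R) <= 1 :> R.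
Proof.
move=> n_gt0; have n0 : 0 < n%:R :> R by rewrite ltr0n.
rewrite -ln_div ?posrE ?ltr0n // mulrC -ler_pdivlMr // mul1r.
apply: le_trans (ln_le_subr1 _) _; first by rewrite divr_gt0 ?ltr0n.
by rewrite -natr1 mulrDl mulfV ?gt_eqF // mul1r addrAC subrr add0r.
Qed.

Lemma ln1D_div_antitone x y : 1 <= x -> x <= y -> (1 + ln y) / y <= (1 + ln x) / x.
Proof.
move=> x1 xy; have x0 : 0 < x by lra. have y0 : 0 < y by lra.
have ln_y : ln y <= ln x + (y / x - 1).
  by rewrite -lerBlDl -ln_div ?posrE //; apply/ln_le_subr1/divr_gt0.
have yx1 : 1 <= y / x by rewrite ler_pdivlMr // mul1r.
rewrite ler_pdivrMr // mulrAC -[leRHS]mulrA mulrDl mul1r.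
by have := ler_wpM2l (ln_ge0 x1) yx1; lra.
Qed.

Lemma sumr_const_from1 N x : \sum_(1 <= d < N.+1) x = N%:R * x.
Proof. by rewrite sumr_const_nat subSS subn0 mulr_natl. Qed.

Lemma sum_ln_quotient_le N :
  \sum_(1 <= d < N.+1) (ln N%:R - ln d%:R) <= N%:R :> R.
Proof.
elim: N => [|N IHN]; first by rewrite big_geq.
rewrite big_nat_recr //= subrr addr0.
have -> : \sum_(1 <= d < N.+1) (ln N.+1%:R - ln d%:R) =
  \sum_(1 <= d < N.+1) (ln N%:R - ln d%:R) + N%:R * (ln N.+1%:R - ln N%:R) :> R.
  by rewrite -sumr_const_from1 -big_split /=; apply: eq_bigr => d _; ring.
rewrite -[leRHS]natr1; apply: lerD => //.
by case: N {IHN} => [|N]; [rewrite mul0r|exact: ln_natS_sub_le].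
Qed.

Lemma sum_ln_ge N : N%:R * (ln N%:R - 1) <= \sum_(1 <= d < N.+1) ln d%:R :> R.
Proof. by have := sum_ln_quotient_le N; rewrite sumrB sumr_const_from1; lra. Qed.

Lemma sum_ln_le N : \sum_(1 <= d < N.+1) ln d%:R <= N%:R * ln N%:R :> R.
Proof.
rewrite -sumr_const_from1; apply: ler_sum_nat => d /andP[d_gt0 le_dN].
by rewrite ler_ln ?posrE ?ltr0n ?ler_nat // (leq_trans d_gt0).
Qed.

Lemma ln_div_le_telescope m : (0 < m)%N ->
  ln m.+1%:R / (m.+1%:R * (m.+1%:R - 1)) <=
  (ln m%:R + 2) / m%:R - (ln m.+1%:R + 2) / m.+1%:R :> R.
Proof.
move=> m_gt0; have step_le := ln_natS_sub_le m_gt0.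
have step_le1 : ln m.+1%:R - ln m%:R <= 1 :> R.
  apply: le_trans step_le; rewrite ler_peMl ?ler1n //.
  by rewrite subr_ge0 ler_ln ?posrE ?ltr0n // ler_nat.
have m0 : 0 < m%:R :> R by rewrite ltr0n.
set l' := ln m.+1%:R in step_le step_le1 *; set l := ln m%:R in step_le step_le1 *.
rewrite -natr1 addrK; move: m%:R m0 step_le => x x_gt0 step_le.
rewrite [leRHS](_ : _ = ((x + 1) * (l + 2) - x * (l' + 2)) / ((x + 1) * x)); last first.
  by field; apply/andP; split; lra.
by rewrite ler_pM2r ?invr_gt0 ?mulr_gt0 //; lra.
Qed.

Lemma sum_ln_div_le M :
  \sum_(2 <= m < M.+1) ln m%:R / (m%:R * (m%:R - 1)) <= 2 :> R.
Proof.
case: M => [|M]; first by rewrite big_geq.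
rewrite big_add1 /=.
pose f m : R := (ln m%:R + 2) / m%:R.
apply: (@le_trans _ _ (\sum_(1 <= m < M.+1) (- f m.+1 - - f m))).
  apply: ler_sum_nat => m /andP[m_gt0 _].
  by rewrite opprK [leRHS]addrC; exact: ln_div_le_telescope.
rewrite telescope_sumr // opprK addrC /f ln1 add0r divr1 gerBl.
by rewrite divr_ge0 // addr_ge0 ?ln_nat_ge0.
Qed.

Lemma ln_nat_unbounded x : exists2 N, (0 < N)%N & x < ln N%:R.
Proof.
have bound_gt := archi_boundP (expR_ge0 x); exists (Num.bound (expR x)).
  by rewrite -(ltr0n R); exact: lt_trans (expR_gt0 x) bound_gt.
by rewrite -[ltLHS]expRK ltr_ln ?posrE ?expR_gt0 ?(lt_trans (expR_gt0 x) bound_gt).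
Qed.

End Logarithm.

Section MangoldtSums.
Variable R : realType.
Local Notation mangoldt := (mangoldt R).

Definition mangoldt_sum (P : pred nat) N : R :=
  \sum_(1 <= n < N.+1 | P n) mangoldt n / n%:R.

Lemma mangoldt_term_ge0 n : 0 <= mangoldt n / n%:R.
Proof. by rewrite divr_ge0 ?mangoldt_ge0. Qed.

Lemma mangoldt_sum_ge0 P N : 0 <= mangoldt_sum P N.
Proof. by rewrite sumr_ge0 // => n _; exact: mangoldt_term_ge0. Qed.

Lemma mangoldt_sumID Q P N :
  mangoldt_sum P N = mangoldt_sum (predI P Q) N + mangoldt_sum (predI P (predC Q)) N.
Proof. exact: bigID. Qed.

Lemma le_mangoldt_sum (P Q : pred nat) N :
  (forall n, P n -> Q n) -> mangoldt_sum P N <= mangoldt_sum Q N.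
Proof.
move=> subPQ; rewrite [leRHS](mangoldt_sumID P) /mangoldt_sum.
rewrite [X in _ <= X + _](eq_bigl P) ?lerDl ?mangoldt_sum_ge0 // => n /=.
by case: (boolP (P n)) => [/subPQ->|]; rewrite ?andbF.
Qed.

Lemma mangoldt_le_ln n : mangoldt n <= ln n%:R.
Proof.
case: n => [|n]; first by rewrite ln0.
rewrite -sum_mangoldt // (big_rem n.+1) ?divisors_id //= lerDl.
by rewrite sumr_ge0 // => d _; exact: mangoldt_ge0.
Qed.

Lemma sum_mangoldt_floor N :
  \sum_(1 <= n < N.+1) mangoldt n *+ (N %/ n) = \sum_(1 <= n < N.+1) ln n%:R.
Proof.
under [RHS]eq_big_nat => n /andP[n_gt0 _] do rewrite -sum_mangoldt //.
rewrite -(sum_divisors_exchange (fun d _ => mangoldt d)).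
by apply: eq_bigr => n _; rewrite sumr_const_nat subSS subn0.
Qed.

Lemma mangoldt_sum_ge N : (0 < N)%N -> ln N%:R - 1 <= mangoldt_sum xpredT N.
Proof.
move=> N_gt0; have N0 : 0 < N%:R :> R by rewrite ltr0n.
rewrite -(ler_pM2l N0); apply: le_trans (sum_ln_ge R N) _.
rewrite -sum_mangoldt_floor mulr_sumr; apply: ler_sum_nat => n /andP[n_gt0 _].
rewrite mulrCA -[mangoldt n *+ _]mulr_natr ler_wpM2l ?mangoldt_ge0 //.
by rewrite ler_pdivlMr ?ltr0n // -natrM ler_nat leq_trunc_div.
Qed.

(* For [n <= N] we have [2 N / n >= 2], hence [floor (2 N / n) >= 2/3 * (2 N / n)]. *)
Lemma mangoldt_sum_le N : (0 < N)%N ->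
  mangoldt_sum xpredT N <= 3 / 2 * (ln N%:R + ln 2).
Proof.
move=> N_gt0; have N0 : 0 < N%:R :> R by rewrite ltr0n.
have N20 : 0 < (4 / 3) * N%:R :> R by lra.
rewrite -(ler_pM2l N20).
apply: (@le_trans _ _ ((2 * N)%N%:R * ln (2 * N)%N%:R)); last first.
  by rewrite natrM lnM ?posrE ?ltr0n //; lra.
apply: le_trans (sum_ln_le R _); rewrite -sum_mangoldt_floor.
rewrite [leRHS](@big_cat_nat _ _ _ N.+1) //=; last by rewrite ltnS leq_pmull.
rewrite ler_wpDr ?sumr_ge0 // => [n _|]; first by rewrite mulrn_wge0 ?mangoldt_ge0.
rewrite mulr_sumr; apply: ler_sum_nat => n /andP[n_gt0 le_nN].
rewrite mulrCA -[mangoldt n *+ _]mulr_natr ler_wpM2l ?mangoldt_ge0 //.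
rewrite ler_pdivrMr ?ltr0n // -natrM mulrAC ler_pdivrMr ?ltr0n // -!natrM ler_nat.
rewrite ltnS in le_nN.
have := divn_eq (2 * N) n; have := ltn_pmod (2 * N) n_gt0.
have : (2 <= 2 * N %/ n)%N by rewrite leq_divRL // leq_mul2l.
nia.
Qed.

Definition proper_powers N : seq nat :=
  [seq (p ^ k)%N | p <- index_iota 2 N.+1, k <- index_iota 2 N.+1].

Lemma mem_proper_powers N n : (0 < n <= N)%N -> ~~ prime n -> mangoldt n != 0 ->
  n \in proper_powers N.
Proof.
move=> /andP[n_gt0 le_nN] n_npr /mangoldt_neq0[p [k [p_pr k_gt0 nE]]].
have p_gt1 := prime_gt1 p_pr.
have k_gt1 : (1 < k)%N.
  by case: k k_gt0 nE => [|[|]] // _; rewrite expn1 => nE; rewrite nE p_pr in n_npr.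
apply/allpairsP; exists (p, k); split=> //=; rewrite mem_index_iota ltnS ?p_gt1 ?k_gt1.
  by apply: leq_trans le_nN; rewrite nE -{1}(expn1 p) leq_exp2l.
by apply: leq_trans le_nN; rewrite nE ltnW // ltn_expl.
Qed.

Lemma mangoldt_sum_nonprime_le N : mangoldt_sum (fun n => ~~ prime n) N <= 2.
Proof.
apply: (@le_trans _ _ (\sum_(n <- proper_powers N) mangoldt n / n%:R)).
  rewrite /mangoldt_sum -big_filter (bigID (fun n => mangoldt n != 0)) /=.
  rewrite [X in _ + X]big1 => [|n /negPn/eqP->]; last by rewrite mul0r.
  rewrite addr0 -big_filter; apply: ler_sum_subset => [|n|n _].
  - by rewrite !filter_uniq ?iota_uniq.
  - rewrite !mem_filter mem_index_iota => /and3P[? ? ?].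
    exact: mem_proper_powers.
  exact: mangoldt_term_ge0.
apply: le_trans (sum_ln_div_le R N); rewrite big_allpairs_dep /=.
apply: ler_sum_nat => p /andP[p_gt1 _]; have p1 : 1 < p%:R :> R by rewrite ltr1n.
apply: (@le_trans _ _ (\sum_(2 <= k < N.+1) ln p%:R * p%:R^-1 ^+ k)).
  apply: ler_sum_nat => k /andP[k_gt1 _]; rewrite mangoldtX ?(ltnW k_gt1) //.
  by rewrite natrX exprVn ler_wpM2r ?invr_ge0 ?exprn_ge0 ?mangoldt_le_ln.
rewrite -mulr_sumr ler_wpM2l ?ln_nat_ge0 //.
apply: le_trans (sum_exprn_le _ _ _) _; first by rewrite invr_ge0 ltW ?invf_lt1; lra.
rewrite (_ : _ / _ = (p%:R * (p%:R - 1))^-1) //.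
by field; rewrite !gt_eqF; lra.
Qed.

Lemma mangoldt_sum_few_primes_le (P : pred nat) B N :
  (forall p, P p -> prime p -> (p <= B)%N) ->
  mangoldt_sum P N <= mangoldt_sum xpredT B + 2.
Proof.
move=> P_le; rewrite (mangoldt_sumID prime); apply: lerD; last first.
  by apply: le_trans (mangoldt_sum_nonprime_le N); apply: le_mangoldt_sum => n /andP[].
rewrite /mangoldt_sum -big_filter; apply: ler_sum_subset => [|n|n _].
- by rewrite filter_uniq ?iota_uniq.
- rewrite mem_filter !mem_index_iota !ltnS => /andP[/andP[Pn n_pr] /andP[n_gt0 _]].
  by rewrite n_gt0 P_le.
exact: mangoldt_term_ge0.
Qed.

End MangoldtSums.

(** * Sums twisted by a completely multiplicative function *)

Section BoundedSequences.
Variables (R : numDomainType) (V : normedZmodType R).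
Implicit Types (u : nat -> V).

Definition bounded_seq u : Prop := exists B : R, forall n, `|u n| <= B.

Lemma bounded_seq_gt0 u (B : R) :
  (forall n, (0 < n)%N -> `|u n| <= B) -> bounded_seq u.
Proof.
move=> u_le; exists (`|u 0%N| + `|u 1%N| + B).
have B_ge0 : 0 <= B := le_trans (normr_ge0 _) (u_le 1%N isT).
case=> [|n]; first by rewrite -addrA lerDl addr_ge0.
by rewrite (le_trans (u_le n.+1 isT)) // lerDr addr_ge0.
Qed.

Lemma bounded_seq_sum (I : Type) (s : seq I) (P : pred I) (u : I -> nat -> V) :
  (forall i, P i -> bounded_seq (u i)) ->
  bounded_seq (fun n => \sum_(i <- s | P i) u i n).
Proof.
move=> bdd_u; elim: s => [|i s [B sum_le]].
  by exists 0 => n; rewrite big_nil normr0.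
have [Pi|/negbTE Pi] := boolP (P i); last first.
  by exists B => n; rewrite big_cons Pi.
have [Bi u_le] := bdd_u i Pi; exists (Bi + B) => n; rewrite big_cons Pi.
exact: le_trans (ler_normD _ _) (lerD (u_le n) (sum_le n)).
Qed.

End BoundedSequences.

Section TwistedSums.
Variables (R : realType) (chi : nat -> Rcomplex R).
Local Notation C := (Rcomplex R).
Local Notation bounded_seqC := (@bounded_seq R C).
Local Notation mobius := (mobius R).
Local Notation mangoldt := (mangoldt R).
Implicit Types (f g : nat -> R) (N : nat).

Definition twisted_sum f N : C := \sum_(1 <= n < N.+1) (f n / n%:R) *: chi n.

Definition twisted_quotient_sum f (z : nat -> C) N : C :=
  \sum_(1 <= d < N.+1) ((f d / d%:R) *: chi d) * z (N %/ d)%N.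

Hypothesis chi1 : chi 1 = 1.
Hypothesis chiM : {morph chi : m n / (m * n)%N >-> m * n}.
Hypothesis norm_chi_le1 : forall n, normC (chi n) <= 1.

Lemma eq_twisted_sum f g N :
  (forall n, (0 < n <= N)%N -> f n = g n) -> twisted_sum f N = twisted_sum g N.
Proof. by move=> eq_fg; apply: eq_big_nat => n bnd; rewrite eq_fg. Qed.

Lemma twisted_sumD f g N : twisted_sum (f \+ g) N = twisted_sum f N + twisted_sum g N.
Proof. by rewrite -big_split; apply: eq_bigr => n _; rewrite mulrDl scalerDl. Qed.

Lemma twisted_sum_delta (c : R) N : (0 < N)%N ->
  twisted_sum (fun n => (n == 1%N)%:R * c) N = c *: 1.
Proof.
move=> N_gt0; rewrite /twisted_sum big_ltn // mul1r divr1 chi1 big_nat big1 ?addr0 //.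
by move=> n /andP[n_gt1 _]; rewrite gtn_eqF // !mul0r scale0r.
Qed.

Lemma twisted_sum_dirichlet_mul f g N :
  twisted_sum (dirichlet_mul f g) N = twisted_quotient_sum f (twisted_sum g) N.
Proof.
rewrite /twisted_quotient_sum; under [RHS]eq_bigr => d _ do rewrite mulr_sumr.
rewrite (sum_divisors_exchange
  (fun d m => ((f d / d%:R) *: chi d) * ((g m / m%:R) *: chi m))).
apply: eq_big_nat => n /andP[n_gt0 _]; rewrite mulr_suml scaler_suml.
apply: eq_big_seq => d; rewrite -dvdn_divisors // => dn.
rewrite -scalerAl Rcomplex_scalerAr scalerA -chiM mulnC divnK //; congr (_ *: _).
have -> : n%:R = (n %/ d)%N%:R * d%:R :> R by rewrite -natrM divnK.
by field; rewrite !pnatr_eq0 -!lt0n dvdn_div_gt0 ?(dvdn_gt0 n_gt0 dn).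
Qed.

Lemma twisted_quotient_sumBr f (z : nat -> C) (L : C) N :
  twisted_quotient_sum f (fun n => z n - L) N =
  twisted_quotient_sum f z N - twisted_sum f N * L.
Proof. by rewrite mulr_suml -sumrB; apply: eq_bigr => d _; rewrite mulrBr. Qed.

Lemma norm_twisted_quotient_sum_le f (z : nat -> C) (c : nat -> R) N :
  (forall d, (0 < d <= N)%N -> `|f d| * normC (z (N %/ d)%N) <= c d * d%:R) ->
  normC (twisted_quotient_sum f z N) <= \sum_(1 <= d < N.+1) c d.
Proof.
move=> fz_le; apply: le_trans (ler_norm_sum _ _ _) _.
apply: ler_sum_nat => d bnd; have d0 : 0 < d%:R :> R by rewrite ltr0n; case/andP: bnd.
rewrite Rcomplex_normM Rcomplex_normZ normrM normfV (gtr0_norm d0).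
rewrite -mulrA -(ler_pM2l d0).
rewrite [leLHS](_ : _ = normC (chi d) * (`|f d| * normC (z (N %/ d)%N))); last first.
  by field; rewrite gt_eqF.
by rewrite [leRHS]mulrC; apply: le_trans (fz_le d bnd); rewrite ler_piMl ?mulr_ge0.
Qed.

Lemma twisted_sum_mobius_1 N : (0 < N)%N ->
  twisted_quotient_sum mobius (twisted_sum (fun=> 1)) N = 1.
Proof.
move=> N_gt0; rewrite -twisted_sum_dirichlet_mul -[RHS]scale1r -(twisted_sum_delta _ N_gt0).
by apply: eq_twisted_sum => n /andP[n_gt0 _]; rewrite dirichlet_mulr1 sum_mobius // mulr1.
Qed.

Lemma twisted_sum_mobius_1Dln N : (0 < N)%N ->
  twisted_quotient_sum mobius (twisted_sum (fun n => 1 + ln n%:R)) N =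
  1 + twisted_sum mangoldt N.
Proof.
move=> N_gt0; rewrite -twisted_sum_dirichlet_mul -[X in X + _]scale1r.
rewrite -(twisted_sum_delta _ N_gt0) -twisted_sumD.
apply: eq_twisted_sum => n /andP[n_gt0 _] /=; rewrite mulr1 -sum_mobius // -mobius_ln //.
by rewrite -dirichlet_mulr1 -big_split; apply: eq_bigr => d _; rewrite mulrDr.
Qed.

Lemma twisted_sum_mobius_ln_quotient N : (0 < N)%N ->
  twisted_quotient_sum (fun d => mobius d * (ln N%:R - ln d%:R)) (twisted_sum (fun=> 1)) N =
  twisted_sum mangoldt N + ln N%:R *: 1.
Proof.
move=> N_gt0; rewrite -(twisted_sum_delta _ N_gt0) -twisted_sumD.
rewrite -twisted_sum_dirichlet_mul.
apply: eq_twisted_sum => n /andP[n_gt0 _] /=; rewrite dirichlet_mulr1.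
under eq_bigr => d _ do rewrite mulrBr.
by rewrite sumrB -mulr_suml sum_mobius // sum_mobius_ln // opprK addrC.
Qed.

Lemma natr_div_le N d : (0 < d)%N -> N%:R / d%:R <= (N %/ d).+1%:R :> R.
Proof. by move=> d_gt0; rewrite ler_pdivrMr ?ltr0n // -natrM ler_nat ltnW // ltn_ceil. Qed.

Section SeriesSums.
(* [L] and [L'] are the sums of the series [chi n / n] and [chi n * (1 + ln n) / n]. *)
Variables (K : R) (L L' : C).
Hypothesis K_ge0 : 0 <= K.
Hypothesis tail_L : forall N, normC (twisted_sum (fun=> 1) N - L) <= K / N.+1%:R.
Hypothesis tail_L' : forall N,
  normC (twisted_sum (fun n => 1 + ln n%:R) N - L') <= K * ((1 + ln N.+1%:R) / N.+1%:R).

Lemma twisted_sum_1_quotient_le N d : (0 < d <= N)%N ->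
  normC (twisted_sum (fun=> 1) (N %/ d) - L) <= K / N%:R * d%:R.
Proof.
move=> /andP[d_gt0 le_dN]; have N_gt0 := leq_trans d_gt0 le_dN.
apply: le_trans (tail_L _) _; rewrite -mulrA ler_wpM2l // -[leRHS]invrK invfM invrK.
by rewrite lef_pV2 ?posrE ?divr_gt0 ?ltr0n // natr_div_le.
Qed.

Lemma twisted_sum_1Dln_quotient_le N d : (0 < d <= N)%N ->
  normC (twisted_sum (fun n => 1 + ln n%:R) (N %/ d) - L') <=
  K / N%:R * (1 + (ln N%:R - ln d%:R)) * d%:R.
Proof.
move=> /andP[d_gt0 le_dN]; have N_gt0 := leq_trans d_gt0 le_dN.
have d0 : 0 < d%:R :> R by rewrite ltr0n. have N0 : 0 < N%:R :> R by rewrite ltr0n.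
apply: le_trans (tail_L' _) _.
rewrite [leRHS](_ : _ = K * ((1 + ln (N%:R / d%:R)) / (N%:R / d%:R))).
  rewrite ler_wpM2l //; apply: ln1D_div_antitone; last exact: natr_div_le.
  by rewrite ler_pdivlMr // mul1r ler_nat.
by rewrite ln_div ?posrE //; field; rewrite !gt_eqF.
Qed.

Lemma twisted_sum_mobius_bounded : L != 0 -> bounded_seqC (twisted_sum mobius).
Proof.
move=> L_neq0; apply: (@bounded_seq_gt0 _ _ _ ((1 + K) / normC L)) => N N_gt0.
have N0 : 0 < N%:R :> R by rewrite ltr0n.
rewrite ler_pdivlMr ?normr_gt0 // -Rcomplex_normM.
have -> : twisted_sum mobius N * L =
    1 - twisted_quotient_sum mobius (fun m => twisted_sum (fun=> 1) m - L) N.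
  by rewrite twisted_quotient_sumBr twisted_sum_mobius_1 // subKr.
apply: le_trans (ler_normB _ _) _; rewrite Rcomplex_norm1 lerD2l.
apply: le_trans (norm_twisted_quotient_sum_le (c := fun=> K / N%:R) _) _ => [d bnd|].
  by apply: le_trans (twisted_sum_1_quotient_le bnd); rewrite ler_piMl ?norm_mobius_le1.
by rewrite sumr_const_from1 mulrC divfK // gt_eqF.
Qed.

Lemma twisted_sum_mangoldt_bounded : L != 0 -> bounded_seqC (twisted_sum mangoldt).
Proof.
move=> /twisted_sum_mobius_bounded[B mobius_le].
apply: (@bounded_seq_gt0 _ _ _ (1 + normC L' * B + 2 * K)) => N N_gt0.
have N0 : 0 < N%:R :> R by rewrite ltr0n.
have -> : twisted_sum mangoldt N = - 1 + L' * twisted_sum mobius N +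
    twisted_quotient_sum mobius (fun m => twisted_sum (fun n => 1 + ln n%:R) m - L') N.
  by rewrite twisted_quotient_sumBr twisted_sum_mobius_1Dln //; ring.
apply: le_trans (ler_normD _ _) _; apply: lerD.
  apply: le_trans (ler_normD _ _) _; rewrite normrN Rcomplex_norm1 lerD2l.
  by rewrite Rcomplex_normM ler_wpM2l.
apply: le_trans (norm_twisted_quotient_sum_le
  (c := fun d => K / N%:R * (1 + (ln N%:R - ln d%:R))) _) _ => [d bnd|].
  by apply: le_trans (twisted_sum_1Dln_quotient_le bnd); rewrite ler_piMl ?norm_mobius_le1.
rewrite -mulr_sumr big_split /= sumr_const_from1 mulr1.
apply: (@le_trans _ _ (K / N%:R * (N%:R + N%:R))).
  by rewrite ler_wpM2l ?divr_ge0 // lerD2l sum_ln_quotient_le.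
by rewrite mulrDr divfK ?gt_eqF //; lra.
Qed.

Lemma twisted_sum_mangoldtDln_bounded : L = 0 ->
  bounded_seqC (fun N => twisted_sum mangoldt N + ln N%:R *: 1).
Proof.
move=> L0; apply: (@bounded_seq_gt0 _ _ _ K) => N N_gt0.
have N0 : 0 < N%:R :> R by rewrite ltr0n.
rewrite -twisted_sum_mobius_ln_quotient //.
apply: le_trans (norm_twisted_quotient_sum_le
  (c := fun d => (ln N%:R - ln d%:R) * (K / N%:R)) _) _ => [d bnd|].
  have ln_ge0 : 0 <= ln N%:R - ln d%:R :> R.
    by case/andP: bnd => d_gt0 le_dN; rewrite subr_ge0 ler_ln ?posrE ?ltr0n ?ler_nat.
  apply: (@le_trans _ _ ((ln N%:R - ln d%:R) * normC (twisted_sum (fun=> 1) (N %/ d)))).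
    by rewrite normrM (ger0_norm ln_ge0) ler_wpM2r // ler_piMl ?norm_mobius_le1.
  by rewrite -mulrA ler_wpM2l //; have := twisted_sum_1_quotient_le bnd; rewrite L0 subr0.
rewrite -mulr_suml; apply: (@le_trans _ _ (N%:R * (K / N%:R))).
  by rewrite ler_wpM2r ?divr_ge0 ?sum_ln_quotient_le.
by rewrite mulrC divfK ?gt_eqF.
Qed.

End SeriesSums.

Theorem twisted_mangoldt_dichotomy (K : R) :
  (forall i j, normC (\sum_(i <= k < j) chi k) <= K) ->
  bounded_seqC (twisted_sum mangoldt) \/
  bounded_seqC (fun N => twisted_sum mangoldt N + ln N%:R *: 1) /\
  exists B : R, forall N, normC (twisted_sum (fun=> 1) N) <= B / N.+1%:R.
Proof.
move=> sum_chi; have K_ge0 : 0 <= 2 * K.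
  by rewrite mulr_ge0 // (le_trans _ (sum_chi 0 0)).
have [||L tail_L] := Rcomplex_abel_limit (w := fun n => 1 / n%:R) (m := 1) sum_chi.
- by move=> n _; rewrite divr_ge0.
- by move=> n n_gt0; rewrite ler_pM2l // lef_pV2 ?posrE ?ltr0n // ler_nat.
have [||L' tail_L'] :=
  Rcomplex_abel_limit (w := fun n => (1 + ln n%:R) / n%:R) (m := 1) sum_chi.
- by move=> n _; rewrite divr_ge0 ?addr_ge0 ?ln_nat_ge0.
- by move=> n n_gt0; apply: ln1D_div_antitone; rewrite ?ler1n ?ler_nat.
have {}tail_L N : normC (twisted_sum (fun=> 1) N - L) <= 2 * K / N.+1%:R.
  by have := tail_L N.+1 isT; rewrite div1r.
have [L0|L_neq0] := eqVneq L 0; [right|left].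
  split; first exact: (twisted_sum_mangoldtDln_bounded K_ge0 tail_L).
  by exists (2 * K) => N; have := tail_L N; rewrite L0 subr0.
apply: (twisted_sum_mangoldt_bounded K_ge0 tail_L (L' := L')) => // N.
exact: tail_L' N.+1 isT.
Qed.

End TwistedSums.

(** * Real characters *)

Section GeometricSums.
Variable R : realFieldType.
Implicit Types x y : R.

Lemma sum_exprn_ge1 x n : 0 <= x -> (0 < n)%N -> 1 <= \sum_(i < n) x ^+ i.
Proof.
move=> x_ge0; case: n => // n _; rewrite big_ord_recl lerDl sumr_ge0 // => i _.
exact: exprn_ge0.
Qed.

Lemma sum_exprn_gt0 x n : 0 <= x -> (0 < n)%N -> 0 < \sum_(i < n) x ^+ i.
Proof. by move=> x_ge0 n_gt0; exact: lt_le_trans ltr01 (sum_exprn_ge1 x_ge0 n_gt0). Qed.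

Lemma lambert_series_term x d k : 0 <= x -> (0 < d)%N ->
  (1 - x) * \sum_(1 <= m < k.+1) x ^+ (d * m) =
  (x ^+ d - x ^+ (d * k.+1)) / \sum_(i < d) x ^+ i.
Proof.
move=> x_ge0 d_gt0; apply: (canRL (mulfK _)).
  by rewrite gt_eqF ?sum_exprn_gt0.
have geomE : (1 - x) * \sum_(i < d) x ^+ i = 1 - x ^+ d.
  by rewrite -[RHS]opprB subrX1 -mulNr opprB.
rewrite mulrAC geomE mulr_sumr.
rewrite (telescope_sumr_eq (fun m => - x ^+ (d * m))) // ?muln1 => [|m _].
  by rewrite opprK addrC.
by rewrite mulnS exprD; ring.
Qed.

Lemma exprn_mul1D_le1 y n : 0 <= y <= 1 -> y ^+ n * (1 + n%:R * (1 - y)) <= 1.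
Proof.
move=> /andP[y_ge0 y_le1]; elim: n => [|n]; first by rewrite mul1r mul0r addr0.
apply: le_trans; rewrite exprSr -mulrA ler_wpM2l ?exprn_ge0 // -natr1.
have : 0 <= (n%:R + 1) * (1 - y) ^+ 2 by rewrite mulr_ge0 ?sqr_ge0 ?addr_ge0.
lra.
Qed.

Lemma bernoulli x n : 0 <= x <= 1 -> 1 - n%:R * (1 - x) <= x ^+ n.
Proof.
move=> /andP[x_ge0 x_le1]; elim: n => [|n IHn]; first by rewrite mul0r subr0.
rewrite exprSr; apply: le_trans (ler_wpM2r x_ge0 IHn); rewrite -natr1.
have : 0 <= n%:R * (1 - x) ^+ 2 by rewrite mulr_ge0 ?sqr_ge0.
lra.
Qed.

Lemma sum_signed_exprn_ge x k : x \in [:: 0; 1; -1] ->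
  (~~ odd k)%:R <= \sum_(i < k.+1) x ^+ i.
Proof.
rewrite !inE => /or3P[] /eqP->.
- rewrite big_ord_recl big1 ?addr0 ?lern1 ?leq_b1 // => i _.
  by rewrite expr0n.
- under eq_bigr => i _ do rewrite expr1n.
  by rewrite sumr_const card_ord ler_nat (leq_trans (leq_b1 _)).
suff -> : \sum_(i < k.+1) (-1) ^+ i = (~~ odd k)%:R :> R by [].
elim: k => [|k IHk]; first by rewrite big_ord1.
by rewrite big_ord_recr IHk /= exprS -signr_odd; case: (odd k) => /=; ring.
Qed.

End GeometricSums.

Lemma le0_of_le_divn (R : archiRealFieldType) (a c : R) m :
  (forall n, (m <= n)%N -> a <= c / n.+1%:R) -> a <= 0.
Proof.
move=> a_le; rewrite leNgt; apply/negP => a_gt0.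
have := archi_boundP (normr_ge0 (c / a)); set j := Num.bound _ => j_gt.
have := a_le (m + j)%N (leq_addr _ _); rewrite ler_pdivlMr ?ltr0n // leNgt => /negP; apply.
rewrite mulrC -ltr_pdivrMr //; apply: le_lt_trans (ler_norm _) _.
by apply: lt_le_trans j_gt _; rewrite ler_nat leqW // leq_addl.
Qed.

Section LambertGap.
Variable R : rcfType.
Implicit Types x y : R.

(* AM-GM for the [i]-th term and the [i]-th term from the end. *)
Lemma sum_exprn_sqr_ge y n : n.+1%:R * y ^+ n <= \sum_(i < n.+1) (y ^+ 2) ^+ i.
Proof.
rewrite -(ler_pM2l (ltr0n _ 2)) [leRHS]mulr_natl mulr2n.
rewrite [X in _ <= _ + X](reindex_inj rev_ord_inj) -big_split /=.
apply: (@le_trans _ _ (\sum_(i < n.+1) 2 * y ^+ n)).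
  by rewrite sumr_const card_ord -[leRHS]mulr_natl mulrCA.
apply: ler_sum => i _; rewrite subSS -!exprM ![(2 * _)%N]mulnC !exprM.
have le_in : (i <= n)%N by rewrite -ltnS.
rewrite -{1}(subnKC le_in) exprD.
by have := sqr_ge0 (y ^+ i - y ^+ (n - i)); rewrite !expr2; lra.
Qed.

Lemma sum_exprn_mul_ge x n : 0 <= x <= 1 -> (0 < n)%N ->
  n%:R * n.+1%:R * x ^+ n <= (\sum_(i < n) x ^+ i) * (\sum_(i < n.+1) x ^+ i).
Proof.
move=> /andP[x_ge0 x_le1]; case: n => // n _.
rewrite -{1 2 3}(sqr_sqrtr x_ge0); set y := Num.sqrt x.
have y_ge0 : 0 <= y := sqrtr_ge0 x.
have y_le1 : y <= 1 by rewrite -sqrtr1 ler_sqrt.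
apply: le_trans (ler_pM _ _ (sum_exprn_sqr_ge y n) (sum_exprn_sqr_ge y n.+1));
  rewrite ?mulr_ge0 ?exprn_ge0 //.
rewrite mulrACA -exprD ler_wpM2l ?mulr_ge0 // -exprM ler_wiXn2l //.
by rewrite mul2n -addnn addSn leqnSn.
Qed.

Definition lambert_gap x n := n%:R^-1 - x ^+ n / \sum_(i < n) x ^+ i.

Lemma lambert_gap_ge0 x n : 0 <= x <= 1 -> (0 < n)%N -> 0 <= lambert_gap x n.
Proof.
move=> /andP[x_ge0 x_le1] n_gt0; rewrite subr_ge0 ler_pdivrMr ?sum_exprn_gt0 //.
rewrite ler_pdivlMl ?ltr0n // (_ : _ * x ^+ n = \sum_(i < n) x ^+ n).
  by apply: ler_sum => i _; apply: ler_wiXn2l => //; exact: ltnW.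
by rewrite sumr_const card_ord mulr_natl.
Qed.

Lemma lambert_gap_antitone x n : 0 <= x <= 1 -> (0 < n)%N ->
  lambert_gap x n.+1 <= lambert_gap x n.
Proof.
move=> x01 n_gt0; have /andP[x_ge0 _] := x01; rewrite /lambert_gap.
have := sum_exprn_mul_ge x01 n_gt0.
have := sum_exprn_gt0 x_ge0 n_gt0; have := sum_exprn_gt0 x_ge0 (ltn0Sn n).
have -> : \sum_(i < n.+1) x ^+ i = 1 + x * \sum_(i < n) x ^+ i.
  by rewrite big_ord_recl mulr_sumr; congr (_ + _); apply: eq_bigr => i _; rewrite -exprS.
set P := \sum_(i < n) x ^+ i => P'_gt0 P_gt0 PP'_ge.
have n0 : 0 < n%:R :> R by rewrite ltr0n.
have n1 : 0 < n%:R + 1 :> R by rewrite natr1 ltr0n.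
rewrite -subr_ge0 exprS -natr1.
rewrite (_ : _ - _ = (P * (1 + x * P) - n%:R * (n%:R + 1) * x ^+ n) /
    (n%:R * (n%:R + 1) * (P * (1 + x * P)))); last first.
  by field; rewrite !gt_eqF.
rewrite divr_ge0 ?subr_ge0 ?natr1 //.
by rewrite !mulr_ge0 // ltW.
Qed.

Lemma natr_exprn_le x : 0 < x < 1 ->
  exists c : R, forall n, n%:R * x ^+ n <= c / n.+1%:R.
Proof.
move=> /andP[x_gt0 x_lt1]; pose y := Num.sqrt x; pose u := 1 - y.
have y_gt0 : 0 < y by rewrite sqrtr_gt0.
have y_lt1 : y < 1 by rewrite -sqrtr1 ltr_sqrt.
have u_gt0 : 0 < u by rewrite subr_gt0.
exists (u ^+ 2)^-1 => n; have yn_ge0 : 0 <= y ^+ n := exprn_ge0 n (ltW y_gt0).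
have yn_le : y ^+ n * (1 + n%:R * u) <= 1 by apply: exprn_mul1D_le1; rewrite !ltW.
have n_ge0 : 0 <= n%:R :> R by [].
rewrite ler_pdivlMr ?ltr0n // -[leRHS]mul1r ler_pdivlMr ?exprn_gt0 // -natr1.
rewrite -(sqr_sqrtr (ltW x_gt0)) -/y exprAC.
have yn1_le : y ^+ n * (n%:R + 1) * u <= 1.
  by apply: le_trans yn_le; rewrite -mulrA ler_wpM2l // /u; lra.
have yn0_le : y ^+ n * n%:R * u <= 1.
  by apply: le_trans yn_le; rewrite -mulrA ler_wpM2l // lerDr.
have ynu_ge0 : 0 <= y ^+ n * n%:R * u by rewrite !mulr_ge0 // ltW.
have ynu1_ge0 : 0 <= y ^+ n * (n%:R + 1) * u by rewrite natr1 !mulr_ge0 // ltW.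
rewrite (_ : _ * u ^+ 2 = (y ^+ n * n%:R * u) * (y ^+ n * (n%:R + 1) * u)); last by ring.
by rewrite -[leRHS]mulr1 ler_pM.
Qed.

End LambertGap.

Section RealCharacterSum.
Variables (R : realType) (r : nat -> R).
Hypothesis r1 : r 1 = 1.
Hypothesis rM : {morph r : m n / (m * n)%N >-> m * n}.
Hypothesis r_val : forall n, r n \in [:: 0; 1; -1].

Definition divisor_sum n := \sum_(d <- divisors n) r d.

Lemma multiplicativeX n k : r (n ^ k) = r n ^+ k.
Proof. by elim: k => [|k IHk]; [rewrite r1|rewrite expnS exprS rM IHk]. Qed.

Lemma divisor_sum_pfactor p k n : prime p -> (0 < n)%N -> ~~ (p %| n)%N ->
  divisor_sum (p ^ k * n) = (\sum_(i < k.+1) r p ^+ i) * divisor_sum n.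
Proof.
move=> p_pr n_gt0 pNn; rewrite /divisor_sum sum_divisors_pfactor // mulr_suml.
apply: eq_bigr => i _; rewrite mulr_sumr; apply: eq_bigr => d _.
by rewrite rM multiplicativeX.
Qed.

Lemma divisor_sum_ge0 n : (0 < n)%N -> 0 <= divisor_sum n.
Proof.
move: n; apply: pfactor_ind => [|p k n p_pr pNn n_gt0 IHn].
  by rewrite /divisor_sum big_seq1 r1.
rewrite divisor_sum_pfactor // mulr_ge0 //.
by apply: le_trans (sum_signed_exprn_ge k (r_val p)).
Qed.

Lemma divisor_sum_sqr_ge1 n : (0 < n)%N -> 1 <= divisor_sum (n ^ 2).
Proof.
move: n; apply: pfactor_ind => [|p k n p_pr pNn n_gt0 IHn].
  by rewrite /divisor_sum big_seq1 r1.
rewrite expnMn -expnM divisor_sum_pfactor ?expn_gt0 ?n_gt0 ?Euclid_dvdX ?(negbTE pNn) //.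
rewrite -[1]mulr1 ler_pM //.
by have := sum_signed_exprn_ge (k * 2) (r_val p); rewrite oddM andbF.
Qed.

Lemma sum_divisor_sum_sqr_ge j :
  j%:R <= \sum_(1 <= n < (j ^ 2).+1) divisor_sum n.
Proof.
apply: (@le_trans _ _ (\sum_(n <- [seq (i ^ 2)%N | i <- index_iota 1 j.+1]) divisor_sum n)).
  rewrite big_map -[leLHS]mulr1 -sumr_const_from1.
  by apply: ler_sum_nat => i /andP[i_gt0 _]; exact: divisor_sum_sqr_ge1.
apply: ler_sum_subset => [|n|n].
- by rewrite map_inj_uniq ?iota_uniq // => i i' /eqP; rewrite eqn_sqr => /eqP.
- case/mapP=> i; rewrite !mem_index_iota => /andP[i_gt0 le_ij] ->.
  by rewrite expn_gt0 i_gt0 !ltnS leq_exp2r in le_ij *.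
by rewrite mem_index_iota => /andP[n_gt0 _]; exact: divisor_sum_ge0.
Qed.

Definition lambert_sum (x : R) N : R := \sum_(1 <= n < N.+1) divisor_sum n * x ^+ n.

Variables (K B : R).
Hypothesis sum_r : forall i j, `|\sum_(i <= k < j) r k| <= K.
Hypothesis sum_r_div : forall N, `|\sum_(1 <= n < N.+1) r n / n%:R| <= B / N.+1%:R.

Lemma lambert_sum_gapE (x : R) N : 0 <= x ->
  (1 - x) * lambert_sum x N =
  \sum_(1 <= d < N.+1) r d / d%:R - \sum_(1 <= d < N.+1) lambert_gap x d * r d -
  \sum_(1 <= d < N.+1) r d * (x ^+ (d * (N %/ d).+1) / \sum_(i < d) x ^+ i).
Proof.
move=> x_ge0.
have -> : lambert_sum x N =
    \sum_(1 <= d < N.+1) \sum_(1 <= m < (N %/ d).+1) r d * x ^+ (d * m).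
  rewrite (sum_divisors_exchange (fun d m => r d * x ^+ (d * m))).
  apply: eq_big_nat => n /andP[n_gt0 _]; rewrite mulr_suml; apply: eq_big_seq => d.
  by rewrite -dvdn_divisors // => dn; rewrite mulnC divnK.
rewrite mulr_sumr -!sumrB; apply: eq_big_nat => d /andP[d_gt0 _].
rewrite -mulr_sumr mulrCA lambert_series_term // /lambert_gap.
by field; rewrite pnatr_eq0 -lt0n d_gt0 gt_eqF ?sum_exprn_gt0.
Qed.

Lemma lambert_remainder_le (x : R) d N : 0 <= x <= 1 -> (0 < d)%N ->
  `|r d * (x ^+ (d * (N %/ d).+1) / \sum_(i < d) x ^+ i)| <= x ^+ N.
Proof.
move=> /andP[x_ge0 x_le1] d_gt0; have P_ge1 := sum_exprn_ge1 x_ge0 d_gt0.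
have P_gt0 := sum_exprn_gt0 x_ge0 d_gt0.
have r_le1 : `|r d| <= 1.
  by have := r_val d; rewrite !inE => /or3P[] /eqP->; rewrite ?normr0 ?normrN ?normr1.
have quo_ge0 : 0 <= x ^+ (d * (N %/ d).+1) / \sum_(i < d) x ^+ i.
  by rewrite divr_ge0 ?exprn_ge0 // ltW.
rewrite normrM (ger0_norm quo_ge0); apply: le_trans (ler_piMl quo_ge0 r_le1) _.
rewrite ler_pdivrMr //; apply: (@le_trans _ _ (x ^+ N)); last first.
  by rewrite ler_peMr ?exprn_ge0.
by rewrite ler_wiXn2l // mulnC ltnW // ltn_ceil.
Qed.

(* Monsky's argument: [(1 - x) * \sum_n r n * x ^ n / (1 - x ^ n)] differs from
   [\sum_n r n / n] by a sum with monotone weights, to which Abel summation applies. *)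
Lemma lambert_sum_le_finite (x : R) N : 0 <= x <= 1 ->
  (1 - x) * lambert_sum x N <= B / N.+1%:R + K * (1 - x) + N%:R * x ^+ N.
Proof.
move=> x01; have /andP[x_ge0 _] := x01; rewrite lambert_sum_gapE //.
apply: lerD; first apply: lerD.
- exact: le_trans (ler_norm _) (sum_r_div N).
- apply: le_trans (ler_norm _) _; rewrite normrN.
  apply: le_trans (abel_bound _ sum_r _ _) _ => [k k_gt0|k k_gt0|].
  + exact: lambert_gap_ge0.
  + exact: lambert_gap_antitone.
  by rewrite /lambert_gap big_ord1 expr0 expr1 invr1 mulr1 mulrC.
apply: le_trans (ler_norm _) _; rewrite normrN -sumr_const_from1.
apply: le_trans (ler_norm_sum _ _ _) _; apply: ler_sum_nat => d /andP[d_gt0 _].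
exact: lambert_remainder_le.
Qed.

Lemma lambert_sum_le (x : R) N : 0 < x < 1 -> lambert_sum x N <= K.
Proof.
move=> x01; have /andP[x_gt0 x_lt1] := x01.
have [c tail_le] := natr_exprn_le x01.
rewrite -subr_le0 -(pmulr_rle0 _ (_ : 0 < 1 - x)) ?subr_gt0 //.
apply: (@le0_of_le_divn _ _ (B + c) N) => n le_Nn.
have lambert_le : lambert_sum x N <= lambert_sum x n.
  rewrite /lambert_sum [leRHS](@big_cat_nat _ _ _ N.+1) //= lerDl big_nat sumr_ge0 //.
  move=> k /andP[lt_Nk _]; rewrite mulr_ge0 ?exprn_ge0 ?(ltW x_gt0) // divisor_sum_ge0 //.
  exact: leq_trans lt_Nk.
have x_bnd : 0 <= x <= 1 by rewrite !ltW.
apply: (@le_trans _ _ ((1 - x) * (lambert_sum x n - K))).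
  by rewrite ler_wpM2l ?lerB // subr_ge0 ltW.
rewrite mulrBr lerBlDr; apply: le_trans (lambert_sum_le_finite n x_bnd) _.
by rewrite addrAC [K * _]mulrC lerD2r mulrDl lerD2l.
Qed.

Lemma sum_divisor_sum_le N : \sum_(1 <= n < N.+1) divisor_sum n <= K.
Proof.
rewrite -subr_le0.
apply: (@le0_of_le_divn _ _ (\sum_(1 <= k < N.+1) divisor_sum k * k%:R) 1) => n n_gt0.
pose x : R := 1 - n.+1%:R^-1.
have inv_gt0 : 0 < n.+1%:R^-1 :> R by rewrite invr_gt0 ltr0n.
have inv_lt1 : n.+1%:R^-1 < 1 :> R by rewrite invf_lt1 ?ltr0n // ltr1n.
have x01 : 0 < x < 1 by rewrite subr_gt0 inv_lt1 gtrBl inv_gt0.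
rewrite lerBlDr; apply: le_trans (lerD (lexx _) (lambert_sum_le N x01)).
rewrite mulr_suml -big_split; apply: ler_sum_nat => k /andP[k_gt0 _] /=.
rewrite -mulrA -mulrDr ler_peMr ?divisor_sum_ge0 //.
have x_bnd : 0 <= x <= 1 by case/andP: x01 => *; rewrite !ltW.
by have := bernoulli k x_bnd; rewrite [1 - x]subKr lerBlDl.
Qed.

End RealCharacterSum.

Theorem real_character_sum_not_vanishing (R : realType) (r : nat -> R) (K : R) :
  r 1 = 1 -> {morph r : m n / (m * n)%N >-> m * n} ->
  (forall n, r n \in [:: 0; 1; -1]) ->
  (forall i j, `|\sum_(i <= k < j) r k| <= K) ->
  ~ exists B : R, forall N, `|\sum_(1 <= n < N.+1) r n / n%:R| <= B / N.+1%:R.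
Proof.
move=> r1 rM r_val sum_r [B sum_r_div].
have K_ge0 : 0 <= K := le_trans (normr_ge0 _) (sum_r 0 0).
have := archi_boundP K_ge0; rewrite ltNge => /negP; apply.
apply: le_trans (sum_divisor_sum_sqr_ge r1 rM r_val _) _.
exact: (sum_divisor_sum_le r1 rM r_val sum_r sum_r_div).
Qed.

(** * Dirichlet characters *)

Section LogCharacters.
Variables (gT : finGroupType) (h : nat).
Implicit Types f g : {ffun gT -> 'I_h.+1}.

(* Characters of [gT] are represented by their logarithms to the base of a
   primitive root of unity of order [h.+1]. *)
Definition log_chars : {set {ffun gT -> 'I_h.+1}} :=
  [set f : {ffun gT -> 'I_h.+1} | [forall x, forall y, f (x * y)%g == f x + f y]].

Lemma log_charsP f : reflect {morph f : x y / (x * y)%g >-> x + y} (f \in log_chars).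
Proof.
rewrite inE; apply: (iffP forallP) => [fM x y|fM x].
  by have /forallP/(_ y)/eqP := fM x.
by apply/forallP => y; rewrite fM.
Qed.

Lemma log_char1 f : f \in log_chars -> f 1%g = 0.
Proof.
by move=> /log_charsP fM; apply: (addrI (f 1%g)); rewrite -fM mulg1 addr0.
Qed.

Lemma log_chars0 : 0 \in log_chars.
Proof. by apply/log_charsP => x y; rewrite !ffunE addr0. Qed.

Lemma log_charsD f g : f \in log_chars -> g \in log_chars -> f + g \in log_chars.
Proof.
move=> /log_charsP fM /log_charsP gM; apply/log_charsP => x y.
by rewrite !ffunE fM gM addrACA.
Qed.

Lemma log_charsN f : f \in log_chars -> - f \in log_chars.
Proof. by move=> /log_charsP fM; apply/log_charsP => x y; rewrite !ffunE fM opprD. Qed.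

Hypothesis abelian_gT : abelian [set: gT].
Hypothesis card_dvd : (#|[set: gT]| %| h.+1)%N.

Lemma log_chars_separate (u : gT) : u != 1%g -> exists2 f, f \in log_chars & f u != 0.
Proof.
move=> u_neq1; have lin_char := char_abelianP _ abelian_gT.
have [i chi_u] : exists i, u \notin cfker 'chi[[set: gT]]_i.
  apply/existsP; rewrite -negb_forall; apply: contra u_neq1 => /forallP u_ker.
  have /setP/(_ u) := TI_cfker_irr [set: gT]; rewrite inE => <-.
  by apply/bigcapP => i _; exact: u_ker.
rewrite cfkerEirr inE lin_char1 // in chi_u.
have [z z_prim] := C_prim_root_exists (ltn0Sn h).
have log_chi (x : gT) : exists k : 'I_h.+1, 'chi_i x == z ^+ k.
  have /(prim_rootP z_prim)[k ->] : 'chi_i x ^+ h.+1 = 1; last by exists k.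
  have /dvdnP[c ->] : (#[x]%g %| h.+1)%N.
    by apply: dvdn_trans card_dvd; apply: order_dvdG; rewrite inE.
  by rewrite mulnC exprM lin_char_unity_root ?expr1n ?inE.
pose f : {ffun gT -> 'I_h.+1} := [ffun x => xchoose (log_chi x)].
have chiE x : 'chi_i x = z ^+ f x by rewrite ffunE; apply/eqP/(xchooseP (log_chi x)).
exists f; last by apply: contra chi_u => /eqP fu; rewrite chiE fu expr0.
apply/log_charsP => x y; apply: val_inj => /=.
have : 'chi_i (x * y)%g == 'chi_i x * 'chi_i y by rewrite lin_charM ?inE.
by rewrite !chiE -exprD (eq_prim_root_expr z_prim) (modn_small (ltn_ord _)) => /eqP.
Qed.

Variables (F : idomainType) (w : F).
Hypothesis w_prim : h.+1.-primitive_root w.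

Lemma prim_exprD (i j : 'I_h.+1) : w ^+ (i + j)%R = w ^+ i * w ^+ j.
Proof. by rewrite -exprD -(prim_expr_mod w_prim (i + j)%N). Qed.

Lemma prim_expr_eq1 (i : 'I_h.+1) : (w ^+ i == 1) = (i == 0).
Proof. by rewrite -(prim_order_dvd w_prim) /dvdn modn_small. Qed.

Lemma sum_log_chars u : \sum_(f in log_chars) w ^+ f u = (u == 1%g)%:R * #|log_chars|%:R.
Proof.
have [->|u_neq1] := eqVneq u 1%g.
  by rewrite mul1r -sumr_const; apply: eq_bigr => f fX; rewrite log_char1.
have [g gX gu_neq0] := log_chars_separate u_neq1.
rewrite mul0r; apply/eqP; rewrite -(mulrI_eq0 _ (mulfI (_ : w ^+ g u - 1 != 0))).
  rewrite mulrBl mul1r subr_eq0 mulr_sumr [eqbRHS](reindex_inj (addrI g)) /=.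
  apply/eqP/eq_big => [f|f fX]; last by rewrite ffunE prim_exprD.
  apply/idP/idP => [fX|gfX]; first exact: log_charsD.
  by rewrite -(addKr g f) log_charsD // log_charsN.
by rewrite subr_eq0 prim_expr_eq1.
Qed.

End LogCharacters.

Lemma eqn_mod_Zp q m n : (1 < q)%N -> (m == n %[mod q])%N = (m%:R == n%:R :> 'Z_q).
Proof. by move=> q_gt1; rewrite -val_eqE /= !val_Zp_nat. Qed.

Lemma sum_Zp (V : nmodType) q (F : nat -> V) : (1 < q)%N ->
  \sum_(0 <= n < q) F n = \sum_(x : 'Z_q) F x.
Proof. by case: q => [|[|q]] // _; rewrite big_mkord. Qed.

Section DirichletCharacters.
Variables (q h : nat) (F : idomainType) (w : F).
Hypothesis q_gt1 : (1 < q)%N.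
Hypothesis w_prim : h.+1.-primitive_root w.
Local Notation G := {unit 'Z_q}.
Local Notation X := (log_chars G h).
Implicit Types f : {ffun G -> 'I_h.+1}.

Definition dchar f (n : nat) : F :=
  if insub (n%:R : 'Z_q) is Some u then w ^+ f u else 0.

Lemma dchar_unit f n (u : G) : val u = n%:R -> dchar f n = w ^+ f u.
Proof. by move=> un; rewrite /dchar -un valK. Qed.

Lemma unit_of_coprime n : coprime q n -> exists u : G, val u = n%:R.
Proof. by rewrite -unitZpE // => n_unit; exists (FinRing.unit _ n_unit). Qed.

Lemma dchar_nonunit f n : ~~ coprime q n -> dchar f n = 0.
Proof. by rewrite -unitZpE // => n_nonunit; rewrite /dchar insubN. Qed.

Lemma dchar_mod f n : dchar f (n %% q) = dchar f n.
Proof. by rewrite /dchar Zp_nat_mod. Qed.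

Lemma dchar0 n : dchar 0 n = (coprime q n)%:R.
Proof.
have [/unit_of_coprime[u un]|nN] := boolP (coprime q n).
  by rewrite (dchar_unit _ un) ffunE expr0.
by rewrite dchar_nonunit.
Qed.

Lemma dchar1 f : f \in X -> dchar f 1 = 1.
Proof. by move=> fX; rewrite (@dchar_unit f 1 1%g) // log_char1. Qed.

Lemma dcharM f : f \in X -> {morph dchar f : m n / (m * n)%N >-> m * n}.
Proof.
move=> fX m n.
have [/unit_of_coprime[u um]|mN] := boolP (coprime q m); last first.
  by rewrite !(@dchar_nonunit _ m) ?mul0r ?dchar_nonunit // coprimeMr (negbTE mN).
have [/unit_of_coprime[v vn]|nN] := boolP (coprime q n); last first.
  by rewrite !(@dchar_nonunit _ n) ?mulr0 ?dchar_nonunit // coprimeMr (negbTE nN) andbF.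
rewrite (dchar_unit _ um) (dchar_unit _ vn) -(prim_exprD w_prim) -(log_charsP _ fX).
by apply: dchar_unit; rewrite natrM -um -vn.
Qed.

Lemma sum_dchar_period f : f \in X -> f != 0 -> \sum_(0 <= n < q) dchar f n = 0.
Proof.
move=> fX f_neq0; have [u fu_neq0] : exists u, f u != 0.
  apply/existsP; rewrite -negb_forall; apply: contra f_neq0 => /forallP f0.
  by apply/eqP/ffunP => u; rewrite ffunE; apply/eqP.
have uE : val u = (val u : nat)%:R by rewrite natr_Zp.
apply/eqP; rewrite -(mulrI_eq0 _ (mulfI (_ : dchar f (val u) - 1 != 0))); last first.
  by rewrite subr_eq0 (dchar_unit _ uE) (prim_expr_eq1 w_prim).
rewrite mulrBl mul1r subr_eq0 sum_Zp // mulr_sumr.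
rewrite [eqbRHS](reindex_inj (mulrI (valP u))); apply/eqP/eq_bigr => x _.
by rewrite -dcharM // /dchar natrM !natr_Zp.
Qed.

Hypothesis card_dvd : (#|[set: G]| %| h.+1)%N.

Lemma sum_dchar n : \sum_(f in X) dchar f n = (n == 1 %[mod q])%:R * #|X|%:R.
Proof.
rewrite eqn_mod_Zp //; have [/unit_of_coprime[u un]|nN] := boolP (coprime q n).
  under eq_bigr => f _ do rewrite (dchar_unit _ un).
  by rewrite (sum_log_chars (units_Zp_abelian q)) // -un -(inj_eq val_inj).
rewrite big1 => [|f _]; last by rewrite dchar_nonunit.
by case: eqP => [n1|_]; rewrite ?mul0r //; rewrite -unitZpE // n1 unitr1 in nN.
Qed.

End DirichletCharacters.

Lemma sum_periodic_le (R : numDomainType) (V : normedZmodType R) (chi : nat -> V) q m n :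
  (0 < q)%N -> (forall k, chi (k %% q)%N = chi k) -> (forall k, `|chi k| <= 1) ->
  \sum_(0 <= k < q) chi k = 0 -> `|\sum_(m <= k < n) chi k| <= (2 * q)%:R.
Proof.
move=> q_gt0 chi_mod chi_le1 period0.
have periods0 j : \sum_(0 <= i < j * q) chi i = 0.
  elim: j => [|j IHj]; first by rewrite big_geq.
  rewrite (@big_cat_nat _ _ _ (j * q)) ?leq_pmul2r //= IHj add0r.
  rewrite -{1}(add0n (j * q)%N) big_addn mulSn addnK -[RHS]period0.
  by apply: eq_bigr => i _; rewrite -chi_mod addnC modnMDl chi_mod.
have initial_le j : `|\sum_(0 <= i < j) chi i| <= q%:R.
  rewrite (divn_eq j q) (@big_cat_nat _ _ _ (j %/ q * q)) ?leq_addr //= periods0 add0r.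
  apply: le_trans (ler_norm_sum _ _ _) _.
  apply: le_trans (ler_sum _ (fun i _ => chi_le1 i)) _.
  by rewrite sumr_const_nat addKn ler_nat ltnW // ltn_pmod.
have [le_mn|/ltnW le_nm] := leqP m n; last by rewrite big_geq ?normr0.
have -> : \sum_(m <= k < n) chi k = \sum_(0 <= k < n) chi k - \sum_(0 <= k < m) chi k.
  by rewrite (@big_cat_nat _ _ _ m 0 n) //= addrAC subrr add0r.
by rewrite natrM mulr_natl mulr2n (le_trans (ler_normB _ _)) ?lerD.
Qed.

(** * Dirichlet's theorem *)

Section ComplexCharacters.
Variables (R : realType) (q h : nat) (w : Rcomplex R).
Local Notation C := (Rcomplex R).
Local Notation bounded_seqC := (@bounded_seq R C).
Local Notation Re := (@complex.Re R).
Local Notation Im := (@complex.Im R).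
Local Notation G := {unit 'Z_q}.
Local Notation X := (log_chars G h).
Implicit Types (f g : {ffun G -> 'I_h.+1}) (N : nat).

Hypothesis q_gt1 : (1 < q)%N.
Hypothesis w_prim : h.+1.-primitive_root w.

Lemma norm_prim_root : normC w = 1.
Proof.
apply/eqP; rewrite -(@pexpr_eq1 _ _ h.+1) // -Rcomplex_normX.
by rewrite (prim_expr_order w_prim) Rcomplex_norm1.
Qed.

Lemma norm_dchar f n : normC (dchar w f n) = (coprime q n)%:R.
Proof.
have [/(unit_of_coprime q_gt1)[u un]|nN] := boolP (coprime q n).
  by rewrite (dchar_unit _ _ un) Rcomplex_normX norm_prim_root expr1n.
by rewrite dchar_nonunit ?normr0.
Qed.

Lemma norm_dchar_le1 f n : normC (dchar w f n) <= 1.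
Proof. by rewrite norm_dchar lern1 leq_b1. Qed.

Lemma sum_dchar_le f m n : f \in X -> f != 0 ->
  normC (\sum_(m <= k < n) dchar w f k) <= (2 * q)%:R.
Proof.
move=> fX f_neq0; apply: sum_periodic_le => [|k|k|].
- exact: ltnW.
- exact: dchar_mod.
- exact: norm_dchar_le1.
exact: sum_dchar_period.
Qed.

Lemma dcharN f n : f \in X -> dchar w (- f) n = conjc (dchar w f n).
Proof.
move=> fX; have [/(unit_of_coprime q_gt1)[u un]|nN] := boolP (coprime q n); last first.
  by rewrite !dchar_nonunit // (raddf0 (@conjc R)).
have wfu_neq0 : w ^+ f u != 0 by rewrite expf_neq0 // (prim_root_eq0 w_prim).
apply: (mulfI wfu_neq0); rewrite !(dchar_unit _ _ un).
rewrite -(prim_exprD w_prim) ffunE subrr expr0.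
have : normC (w ^+ f u) ^+ 2 = 1 by rewrite Rcomplex_normX norm_prim_root !expr1n.
rewrite Rcomplex_normE sqr_sqrtr ?addr_ge0 ?sqr_ge0 //; case: (w ^+ f u) => a b /= ab.
by apply/eqP; rewrite eq_complex /= -ab; apply/andP; split; apply/eqP; ring.
Qed.

Definition char_sum f : nat -> C := twisted_sum (dchar w f) (mangoldt R).

Lemma norm_char_sumN f N : f \in X -> normC (char_sum (- f) N) = normC (char_sum f N).
Proof.
move=> fX; rewrite -[RHS]Rcomplex_norm_conj; congr normC.
rewrite /char_sum /twisted_sum (raddf_sum (@conjc R)); apply: eq_bigr => n _.
by rewrite dcharN //; case: (dchar w f n) => a b; rewrite /= -[in RHS]mulrN.
Qed.

Lemma char_sum0E N : char_sum 0 N = mangoldt_sum R (coprime q) N *: 1.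
Proof.
rewrite /mangoldt_sum big_mkcond scaler_suml; apply: eq_bigr => n _.
by rewrite dchar0 //; case: ifP => _; rewrite ?scaler0 ?scale0r.
Qed.

Lemma char_sum_dichotomy f : f \in X -> f != 0 ->
  bounded_seqC (char_sum f) \/
  bounded_seqC (fun N => char_sum f N + ln N%:R *: 1) /\
  exists B : R, forall N, normC (twisted_sum (dchar w f) (fun=> 1) N) <= B / N.+1%:R.
Proof.
move=> fX f_neq0; apply: (@twisted_mangoldt_dichotomy R (dchar w f)).
- exact: dchar1.
- exact: dcharM.
- exact: norm_dchar_le1.
by move=> i j; exact: sum_dchar_le.
Qed.

Lemma real_dchar_not_vanishing f : f \in X -> f != 0 -> - f = f ->
  ~ exists B : R, forall N, normC (twisted_sum (dchar w f) (fun=> 1) N) <= B / N.+1%:R.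
Proof.
move=> fX f_neq0 fN [B vanish].
have Im0 n : Im (dchar w f n) = 0.
  by have := dcharN n fX; rewrite fN; case: (dchar w f n) => a b [] /=; lra.
apply: (@real_character_sum_not_vanishing R (fun n => Re (dchar w f n)) (2 * q)%:R).
- by rewrite dchar1.
- move=> m n; rewrite dcharM //; have := Im0 m.
  by case: (dchar w f m) (dchar w f n) => a b [c d] /= ->; rewrite mul0r subr0.
- move=> n; have := norm_dchar f n; rewrite Rcomplex_normE Im0 expr0n addr0 sqrtr_sqr.
  case: (coprime q n) => [/eqP|/normr0_eq0->]; last by rewrite inE eqxx.
  by rewrite eqr_norml ler01 andbT !inE => ->; rewrite orbT.
- move=> i j; rewrite -Re_sum; apply: le_trans (norm_Re_le _) _; exact: sum_dchar_le.
exists B => N; apply: le_trans (vanish N); apply: le_trans (norm_Re_le _).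
rewrite Re_sum; under [X in _ <= `|X|]eq_bigr => n _ do rewrite Re_scale div1r mulrC.
exact: lexx.
Qed.

Hypothesis card_dvd : (#|[set: G]| %| h.+1)%N.

Lemma char_sum_orthogonality b N :
  \sum_(f in X) dchar w f b * char_sum f N =
  (#|X|%:R * mangoldt_sum R (fun n => b * n == 1 %[mod q])%N N) *: 1.
Proof.
under eq_bigr => f _ do rewrite mulr_sumr.
rewrite exchange_big /= mulr_sumr [in RHS]big_mkcond scaler_suml; apply: eq_bigr => n _.
transitivity ((mangoldt R n / n%:R) *: \sum_(f in X) dchar w f (b * n)).
  by rewrite scaler_sumr; apply: eq_bigr => f fX; rewrite Rcomplex_scalerAr dcharM.
rewrite sum_dchar //; case: ifP => _; last by rewrite mul0r scaler0 scale0r.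
by rewrite mul1r -[in LHS](scaler_nat #|X|) scalerA mulrC.
Qed.

(* Otherwise the two of them would push the sum over all characters, which is
   nonnegative, below [3/2 * ln N - 2 * ln N + O(1)]. *)
Lemma at_most_one_char_sum_unbounded f g : f \in X -> f != 0 -> g \in X -> g != 0 ->
  ~ bounded_seqC (char_sum f) -> ~ bounded_seqC (char_sum g) -> f = g.
Proof.
move=> fX f_neq0 gX g_neq0 unb_f unb_g; apply: contrapT => /eqP f_neq_g.
pose unb k : bool := `[< ~ bounded_seqC (char_sum k) >].
pose U := \sum_(k in X | k != 0) (unb k)%:R : R.
have U_ge2 : 2 <= U.
  rewrite /U (bigD1 f) ?fX ?f_neq0 //= (bigD1 g) ?gX ?g_neq0 ?(eq_sym g) //=.
  rewrite /unb !asboolT // addrA lerDl sumr_ge0 // => k _; exact: ler0n.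
have [B sum_le] : bounded_seqC (fun N =>
    \sum_(k in X | k != 0) (char_sum k N + ((unb k)%:R * ln N%:R) *: 1)).
  apply: bounded_seq_sum => k /andP[kX k_neq0]; rewrite /unb.
  have [bdd|unbdd] := pselect (bounded_seqC (char_sum k)).
    rewrite asboolF; last by apply.
    by case: bdd => B k_le; exists B => N; rewrite mul0r scale0r addr0.
  rewrite asboolT //; have [//|[[B k_le] _]] := char_sum_dichotomy kX k_neq0.
  by exists B => N; rewrite mul1r.
have [N N_gt0 ln_gt] := @ln_nat_unbounded R (2 * (B + 3 / 2 * ln 2)).
have all_ge0 : 0 <= Re (\sum_(k in X) char_sum k N).
  have := char_sum_orthogonality 1 N.
  under eq_bigr => k kX do rewrite dchar1 // mul1r.
  by move=> ->; rewrite Re_scale mulr1 mulr_ge0 ?mangoldt_sum_ge0.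
have char0_le : Re (char_sum 0 N) <= 3 / 2 * (ln N%:R + ln 2).
  rewrite char_sum0E Re_scale mulr1; apply: le_trans (mangoldt_sum_le R N_gt0).
  exact: le_mangoldt_sum.
have := le_trans (Re_le_norm _) (sum_le N); rewrite big_split /= -scaler_suml -mulr_suml.
rewrite -/U ReD Re_scale mulr1.
move: all_ge0; rewrite (bigD1 (0 : {ffun G -> 'I_h.+1})) ?log_chars0 //= ReD.
have := ler_wpM2r (ln_nat_ge0 R N) U_ge2.
lra.
Qed.

Lemma char_sum_bounded f : f \in X -> f != 0 -> bounded_seqC (char_sum f).
Proof.
move=> fX f_neq0; apply: contrapT => unb_f.
have [//|[_ vanish]] := char_sum_dichotomy fX f_neq0.
apply: (real_dchar_not_vanishing fX f_neq0 _ vanish).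
apply: at_most_one_char_sum_unbounded => //; rewrite ?log_charsN ?oppr_eq0 //.
by move=> [B bdd]; apply: unb_f; exists B => N; rewrite -norm_char_sumN.
Qed.

Lemma mangoldt_sum_progression_unbounded b (c : R) : coprime q b ->
  exists N, c < mangoldt_sum R (fun n => b * n == 1 %[mod q])%N N.
Proof.
move=> co_qb; apply: contrapT => /forallNP psum_le.
pose c0 := mangoldt_sum R xpredT q + 2.
have [B sum_le] : bounded_seqC (fun N =>
    \sum_(f in X | f != 0) dchar w f b * char_sum f N).
  apply: bounded_seq_sum => f /andP[fX f_neq0]; have [B f_le] := char_sum_bounded fX f_neq0.
  exists B => N; rewrite Rcomplex_normM (le_trans _ (f_le N)) //.
  by rewrite ler_piMl ?norm_dchar_le1.
have [N N_gt0] := @ln_nat_unbounded R (#|X|%:R * c + B + c0 + 1).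
apply/negP; rewrite -leNgt.
have all_le : Re (\sum_(f in X) dchar w f b * char_sum f N) <= #|X|%:R * c.
  rewrite char_sum_orthogonality Re_scale mulr1 ler_wpM2l //.
  by rewrite leNgt; apply/negP; exact: psum_le.
have noncoprime_le : mangoldt_sum R (fun n => ~~ coprime q n) N <= c0.
  apply: mangoldt_sum_few_primes_le => p; rewrite coprime_sym => pN p_pr.
  by rewrite dvdn_leq ?(ltnW q_gt1) //; rewrite prime_coprime // negbK in pN.
have char0_ge : ln N%:R - 1 - c0 <= Re (char_sum 0 N).
  rewrite char_sum0E Re_scale mulr1 lerBlDr.
  apply: le_trans (mangoldt_sum_ge R N_gt0) _; rewrite (mangoldt_sumID R (coprime q)).
  exact: lerD.
have rest_ge : - B <= Re (\sum_(f in X | f != 0) dchar w f b * char_sum f N).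
  by apply: le_trans (oppr_norm_le_Re _); rewrite lerN2.
move: all_le; rewrite (bigD1 (0 : {ffun G -> 'I_h.+1})) ?log_chars0 //=.
rewrite dchar0 // co_qb mul1r ReD.
lra.
Qed.

End ComplexCharacters.

Lemma closed_field_prim_root (F : closedFieldType) n :
  n%:R != 0 :> F -> exists z : F, n.-primitive_root z.
Proof.
move=> n_neq0; have n_gt0 : (0 < n)%N by case: n n_neq0 => //; rewrite eqxx.
have [rs] := closed_field_poly_normal ('X^n - 1 : {poly F}).
rewrite (monicP _) ?monicXnsubC // scale1r => XnE.
have uniq_rs : uniq rs by rewrite -separable_prod_XsubC -XnE separable_Xn_sub_1.
have size_rs : size rs = n.
  by apply: succn_inj; rewrite -(size_prod_XsubC rs id) -XnE size_XnsubC.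
have unity_rs : all n.-unity_root rs.
  by apply/allP => z z_rs; rewrite /root_of_unity XnE root_prod_XsubC.
have /hasP[z _ z_prim] := has_prim_root n_gt0 unity_rs uniq_rs (eq_leq (esym size_rs)).
by exists z.
Qed.

Theorem dirichlet_primes q a B : (0 < q)%N -> coprime q a ->
  exists p, [/\ prime p, (B < p)%N & p = a %[mod q]].
Proof.
rewrite leq_eqVlt => /predU1P[<- _|q_gt1 co_qa].
  by have [p lt_Bp p_pr] := prime_above B; exists p; rewrite !modn1.
apply: contrapT => no_prime; pose R := Rdefinitions.R.
pose h := #|[set: {unit 'Z_q}]|.-1.
have hE : h.+1 = #|[set: {unit 'Z_q}]| by rewrite prednK ?cardG_gt0.
have [w w_prim] : exists w : Rcomplex R, h.+1.-primitive_root w.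
  by apply: (@closed_field_prim_root (complex R)); rewrite pnatr_eq0.
pose b : nat := val ((a%:R : 'Z_q)^-1).
have a_unit : (a%:R : 'Z_q) \is a GRing.unit by rewrite unitZpE.
have bE : (b%:R : 'Z_q) = a%:R^-1 by rewrite natr_Zp.
have co_qb : coprime q b by rewrite -unitZpE // bE unitrV.
have [|N] := @mangoldt_sum_progression_unbounded _ _ _ _ q_gt1 w_prim _ b
  (mangoldt_sum R xpredT B + 2) co_qb; first by rewrite hE.
apply/negP; rewrite -leNgt; apply: mangoldt_sum_few_primes_le => p.
rewrite eqn_mod_Zp // natrM bE -(inj_eq (mulrI a_unit)) mulVKr // mulr1 -eqn_mod_Zp //.
by move=> /eqP pa p_pr; rewrite leqNgt; apply/negP => lt_Bp; apply: no_prime; exists p.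
Qed.

Local Close Scope ring_scope.

(** * Trees *)

Definition prime_exponents (n : nat) : seq nat := [seq logn p n | p <- primes n].

Lemma tree_of_prime_exponents n : tree_of n = Node [seq tree_of e | e <- prime_exponents n].
Proof. by rewrite tree_ofE /prime_exponents -map_comp. Qed.

Lemma primes_cons p e m : prime p -> 0 < e -> 0 < m -> all (ltn p) (primes m) ->
  primes (p ^ e * m) = p :: primes m.
Proof.
move=> p_pr e_gt0 m_gt0 lt_pm; have p_gt0 := prime_gt0 p_pr.
apply: (irr_sorted_eq ltn_trans ltnn) => [||r]; first exact: sorted_primes.
  by rewrite /= path_min_sorted ?sorted_primes.
by rewrite primesM ?expn_gt0 ?p_gt0 // primesX // primes_prime // !inE.
Qed.

Lemma prime_exponents_cons p e m :
  prime p -> 0 < e -> 0 < m -> all (ltn p) (primes m) ->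
  prime_exponents (p ^ e * m) = e :: prime_exponents m.
Proof.
move=> p_pr e_gt0 m_gt0 lt_pm; have p_gt0 := prime_gt0 p_pr.
rewrite /prime_exponents primes_cons //=; congr (_ :: _).
  rewrite lognM ?expn_gt0 ?p_gt0 // pfactorK // (lognE p m).
  case: ifP => [/and3P[_ _ pm]|_]; last by rewrite addn0.
  by have /allP/(_ p) := lt_pm; rewrite mem_primes p_pr m_gt0 pm /= ltnn => /(_ isT).
apply/eq_in_map => r /(allP lt_pm) lt_pr.
by rewrite lognM ?expn_gt0 ?p_gt0 // lognX logn_prime // gtn_eqF ?muln0.
Qed.

Lemma all_ltn_primes B n : 1 < n -> all (ltn B) (primes n) -> B < n.
Proof.
move=> n_gt1 /allP/(_ (pdiv n)); rewrite mem_primes pdiv_prime // pdiv_dvd (ltnW n_gt1) /=.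
by move=> /(_ isT) /leq_trans; apply; exact: pdiv_leq (ltnW n_gt1).
Qed.

Lemma expn_modn_1totient q p e : 0 < q -> coprime q p -> 0 < e ->
  e = 1 %[mod totient q] -> p ^ e = p %[mod q].
Proof.
move=> q_gt0 co_qp e_gt0 e1.
have /dvdnP[k eE] : totient q %| e - 1 by rewrite -eqn_mod_dvd // e1.
have -> : e = (totient q * k).+1 by rewrite mulnC -eE subn1 prednK.
rewrite expnS expnM -modnMmr -modnXm Euler_exp_totient; last by rewrite coprime_sym.
by rewrite modnXm exp1n modnMmr muln1.
Qed.

Definition exponents_1mod k (es : seq nat) : bool :=
  all (fun e => (0 < e) && (e == 1 %[mod k])) es.

Definition exponents_in_class q c (es : seq nat) : Prop :=
  forall B, exists n, [/\ 0 < n, n = c %[mod q], prime_exponents n = es &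
                          all (ltn B) (primes n)].

Section ExponentsInClass.
Variable q : nat.
Hypothesis q_gt0 : 0 < q.

Lemma exponents_in_class_cons c e es :
  coprime q c -> 0 < e -> e = 1 %[mod totient q] ->
  exponents_in_class q 1 es -> exponents_in_class q c (e :: es).
Proof.
move=> co_qc e_gt0 e1 class_es B.
have [p [p_pr lt_Bp pc]] := dirichlet_primes B q_gt0 co_qc.
have [m [m_gt0 m1 <- lt_pm]] := class_es p; have p_gt0 := prime_gt0 p_pr.
have co_qp : coprime q p by rewrite -coprime_modr pc coprime_modr.
exists (p ^ e * m); split.
- by rewrite muln_gt0 expn_gt0 p_gt0.
- by rewrite -modnMm (expn_modn_1totient q_gt0 co_qp) // pc m1 modnMm muln1.
- exact: prime_exponents_cons.
rewrite primes_cons //= lt_Bp; apply: sub_all lt_pm => r.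
exact: ltn_trans.
Qed.

Lemma exponents_in_class1 es : exponents_1mod (totient q) es -> exponents_in_class q 1 es.
Proof.
elim: es => [_ B|e es IHes /= /andP[/andP[e_gt0 /eqP e1] es1]].
  by exists 1.
by apply: exponents_in_class_cons => //; [exact: coprimen1|exact: IHes].
Qed.

Lemma exponents_in_class_coprime c e es : coprime q c ->
  exponents_1mod (totient q) (e :: es) -> exponents_in_class q c (e :: es).
Proof.
move=> co_qc /andP[/andP[e_gt0 /eqP e1] es1].
exact/exponents_in_class_cons/exponents_in_class1.
Qed.

End ExponentsInClass.

Lemma planar_tree_forest_ind (P : planar_tree -> Prop) (Q : seq planar_tree -> Prop) :
  Q [::] -> (forall t ts, P t -> Q ts -> Q (t :: ts)) ->
  (forall ts, Q ts -> P (Node ts)) -> forall t, P t.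
Proof.
move=> Qnil Qcons PNode; fix IHt 1; case=> ts; apply: PNode.
by elim: ts => [|t ts IHts]; [exact: Qnil|exact: Qcons].
Qed.

Lemma planar_tree_exponents t k : 0 < k ->
  exists2 es, exponents_1mod k es & t = Node [seq tree_of e | e <- es].
Proof.
pose Q ts := forall k, 0 < k ->
  exists2 es, exponents_1mod k es & ts = [seq tree_of e | e <- es].
move: t k; apply: (@planar_tree_forest_ind _ Q) => [k _|t ts IHt IHts k k_gt0|ts IHts k].
- by exists [::].
- have [|es es1 tE] := IHt (totient k); first by rewrite totient_gt0.
  have [n [n_gt0 n1 nE _]] := exponents_in_class1 k_gt0 es1 0.
  have [es' es'1 ->] := IHts k k_gt0.
  exists (n :: es'); first by rewrite /= n_gt0 n1 eqxx.
  by rewrite /= tree_of_prime_exponents nE tE.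
by move=> /IHts[es es1 ->]; exists es.
Qed.

Lemma unbounded_infinite (A : set nat) :
  (forall B, exists2 n, A n & B < n) -> infinite_set A.
Proof.
move=> unbounded /finite_seqP[s As]; have [n An] := unbounded (\max_(i <- s) i).
have ns : n \in s by move: An; rewrite As.
by rewrite ltnNge (big_rem _ ns) /= leq_maxl.
Qed.

Local Open Scope classical_set_scope.

Theorem theorem5 (t : planar_tree) (ht : 0 < num_edges t)
    (q : nat) (hq : 1 <= q) (a : int) (haq : coprimez a q%:Z) :
  infinite_set [set n : nat | [/\ 0 < n, (n%:Z = a %[mod q%:Z])%Z
                                & tree_of n = t]].
Proof.
apply: unbounded_infinite => B.
have [|es es1 tE] := @planar_tree_exponents t (totient q); first by rewrite totient_gt0.
case: es es1 tE => [_ tE|e es es1 tE]; first by rewrite tE in ht.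
pose c := absz (a %% q%:Z)%Z.
have cE : (c%:Z = a %% q%:Z)%Z by rewrite gez0_abs // modz_ge0 // eqz_nat -lt0n.
have co_qc : coprime q c.
  by rewrite coprime_sym -[coprime c q]/(coprimez c q) cE /coprimez gcdz_modl.
have [n [n_gt0 nc nE lt_Bn]] := exponents_in_class_coprime hq co_qc es1 B.
exists n; last by apply: all_ltn_primes lt_Bn; case: n n_gt0 nE {nc} => [|[]].
split=> //; last by rewrite tree_of_prime_exponents nE tE.
by rewrite -[RHS]modz_mod -cE !modz_nat nc.
Qed.
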